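(* Let $\Sigma_1,\dots,\Sigma_k$ be tropical hypersurfaces in $\mathbb{R}^n$ whose stable intersection is non-empty, i.e. $\bigwedge_{i=1}^k\Sigma_i\neq\emptyset$. Then every connected component of their (set-theoretic) intersection $\bigcap_{i=1}^k|\Sigma_i|$ contains a point in the support $\left|\bigwedge_{i=1}^k\Sigma_i\right|$ of their stable intersection.
   Context: Fix an algebraically closed field $K$ of characteristic $0$ with a non-trivial valuation $\mathrm{val}\colon K^\ast\to\mathbb{R}$ and an element $t\in K^\ast$ with $\mathrm{val}(t)=1$. Let $K[x_1^{\pm1},\dots,x_n^{\pm1}]$ be the Laurent polynomial ring over $K$. Balanced polyhedral complexes. A ''balanced polyhedral complex'' in $\mathbb{R}^n$ means a finite polyhedral complex $\Sigma$ in $\mathbb{R}^n$ that is pure (all maximal cells have the same dimension $d$), weighted (each maximal cell $\sigma$ carries a positive integer weight $\mathrm{mult}(\sigma)$) and balanced: cells have rational linear spans, and for every $(d-1)$-dimensional cell $\tau$ one has $\sum_{\sigma\supset\tau}\mathrm{mult}(\sigma)\,u_{\sigma/\tau}\in\mathrm{span}(\tau-\tau)$, where the sum is over the maximal cells $\sigma\supset\tau$ and $u_{\sigma/\tau}\in\mathbb{Z}^n$ is an integer vector pointing from $\tau$ into $\sigma$ which generates $(\mathrm{span}(\sigma-\sigma)\cap\mathbb{Z}^n)/(\mathrm{span}(\tau-\tau)\cap\mathbb{Z}^n)$. The support $|\Sigma|\subseteq\mathbb{R}^n$ is the union of all cells of $\Sigma$. Tropical hypersurfaces. For a non-zero $f=\sum_{\alpha}c_\alpha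 x^\alpha\in K[x_1^{\pm1},\dots,x_n^{\pm1}]$, the tropical hypersurface of $f$ is the balanced polyhedral complex with support $\{w\in\mathbb{R}^n : \min_{\alpha:\,c_\alpha\neq 0}(\mathrm{val}(c_\alpha)+w\cdot\alpha)\text{ is attained for at least two }\alpha\}$, with cells dual to the positive-dimensional cells of the regular subdivision of the Newton polytope of $f$ induced by the heights $\mathrm{val}(c_\alpha)$, and with the weight of a maximal cell being the lattice length of its dual edge. A tropical hypersurface in $\mathbb{R}^n$ is a balanced polyhedral complex arising in this way. Stable intersection. For balanced polyhedral complexes $\Sigma_1,\Sigma_2$ in $\mathbb{R}^n$, the stable intersection $\Sigma_1\wedge\Sigma_2$ is the polyhedral complex consisting of the non-empty polyhedra $\sigma_1\cap\sigma_2$ with $\sigma_1\in\Sigma_1$, $\sigma_2\in\Sigma_2$ and $\dim(\sigma_1+\sigma_2)=n$ (Minkowski sum), together with their faces. In particular, $|\Sigma_1\wedge\Sigma_2|=\bigcup_{\dim(\sigma_1+\sigma_2)=n}\sigma_1\cap\sigma_2$. The weight of a maximal cell $\sigma$ is $\sum_{\tau_1,\tau_2}\mathrm{mult}(\tau_1)\,\mathrm{mult}(\tau_2)\,[\mathbb{Z}^n:N_{\tau_1}+N_{\tau_2}]$, the sum being over maximal cells $\tau_i\in\Sigma_i$ containing $\sigma$ with $\tau_1\cap(\varepsilon v+\tau_2)\neq\emptyset$ for all sufficiently small $\varepsilon>0$, for a fixed generic $v\in\mathbb{R}^n$, where $N_{\tau}=\mathrm{span}(\tau-\tau)\cap\mathbb{Z}^n$.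 When non-empty, $\Sigma_1\wedge\Sigma_2$ is again a balanced polyhedral complex. The operation is associative and commutative, and $\bigwedge_{i=1}^k\Sigma_i$ denotes the iterated stable intersection $\Sigma_1\wedge\dots\wedge\Sigma_k$ (equal to $\Sigma_1$ if $k=1$). *)

(* Defs.v *)
From mathcomp Require Import all_boot all_order all_algebra.
From mathcomp Require Import finmap.
From mathcomp Require Import mathcomp_extra boolp classical_sets functions.
From mathcomp Require Import cardinality fsbigop reals topology normedtype.
From mathcomp Require Import convex interval_inference ring lra.
Set Implicit Arguments.
Unset Strict Implicit.
Unset Printing Implicit Defensive.
Import Order.TTheory GRing.Theory Num.Theory.
Import numFieldNormedType.Exports.
Local Open Scope classical_set_scope.
Local Open Scope ring_scope.

(* [nu] is only meaningful on nonzero elements: the value [nu 0] is junk and is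
   never constrained nor used. *)
Definition is_valuation (R : realType) (K : fieldType) (nu : K -> R) : Prop :=
  (forall x y, x != 0 -> y != 0 -> nu (x * y) = nu x + nu y) /\
  (forall x y, x != 0 -> y != 0 -> x + y != 0 ->
     Num.min (nu x) (nu y) <= nu (x + y)).

Definition nontrivial_valuation (R : realType) (K : fieldType) (nu : K -> R)
  : Prop := exists2 x, x != 0 & nu x != 0.

(* Coefficient functions of Laurent polynomials: finitely supported functions
   from exponent vectors in Z^n to K. *)
Definition laurent (K : fieldType) (n : nat) :=
  {fsfun 'rV[int]_n -> K with 0}.

Section Geometry.
Variables (R : realType) (n : nat).
Implicit Types (A B P F : set 'rV[R]_n) (w u v : 'rV[R]_n) (a : 'rV[int]_n).

Definition dot w u : R := \sum_j w 0 j * u 0 j.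

Definition of_int a : 'rV[R]_n := map_mx intr a.

Definition minkowski_sum A B : set 'rV[R]_n := [set x + y | x in A & y in B].
Definition minkowski_diff A B : set 'rV[R]_n := [set x - y | x in A & y in B].

Definition is_span A (U : {vspace 'rV[R]_n}) : Prop :=
  (forall x, A x -> x \in U) /\
  (forall V : {vspace 'rV[R]_n}, (forall x, A x -> x \in V) -> (U <= V)%VS).

(* Such a subspace exists and is unique, see [lin_spanP] and [is_span_uniq]. *)
Definition lin_span A : {vspace 'rV[R]_n} := xget 0%VS (is_span A).

Lemma is_span_uniq A U V : is_span A U -> is_span A V -> U = V.
Proof.
move=> [AU Umin] [AV Vmin]; apply: subv_anti.
by rewrite Umin// Vmin.
Qed.

Lemma lin_spanP A : is_span A (lin_span A).
Proof.
rewrite /lin_span; case: xgetP => [U _ //|noU]; exfalso.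
pose T d := `[< exists2 U : {vspace 'rV[R]_n}, \dim U = d &
  forall V : {vspace 'rV[R]_n}, (forall x, A x -> x \in V) -> (U <= V)%VS >].
have T0 : exists d, T d.
  by exists 0%N; apply/asboolP; exists 0%VS => [|V _]; rewrite ?dimv0 ?sub0v.
have Tb d : T d -> (d <= \dim (fullv : {vspace 'rV[R]_n}))%N.
  by move=> /asboolP[U <- _]; apply/dimvS/subvf.
case: (ex_maxnP T0 Tb) => d /asboolP[U dU Umin] dmax.
apply: (noU U); split=> // x Ax; apply/negPn/negP => xU.
have : T (\dim (U + <[x]>)%VS).
  apply/asboolP; exists (U + <[x]>)%VS => // V AV.
  by rewrite subv_add Umin//= -memvE AV.
move=> /dmax; rewrite -dU leqNgt => /negP; apply.
rewrite ltnNge; apply: contra xU => le_d.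
have /eqP eU : U == (U + <[x]>)%VS by rewrite eqEdim addvSl.
by rewrite eU memvE addvSr.
Qed.

Definition direction A := lin_span (minkowski_diff A A).

(* Dimension of the affine hull (the empty set gets dimension 0). *)
Definition dimension A : nat := \dim (direction A).

Definition direction_lattice A : set 'rV[int]_n :=
  [set a | of_int a \in direction A].

Definition lattice_sum (L M : set 'rV[int]_n) : set 'rV[int]_n :=
  [set a + b | a in L & b in M].

(* Number of cosets of L in Z^n; [fset_set] of an infinite set is empty, so
   the value is 0 when the index is infinite. *)
Definition lattice_index (L : set 'rV[int]_n) : nat :=
  #|` fset_set [set [set b | L (b - a)] | a in [set: 'rV[int]_n]]|%fset.

(* For a segment with integral end points. *)
Definition lattice_length A : nat :=
  (#|` fset_set [set a | A (of_int a)]|%fset).-1.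

Definition is_face P F : Prop :=
  F !=set0 /\
  exists u, F = [set x | P x /\ forall y, P y -> dot u x <= dot u y].

(* Cells together with a weight function; only the weights of the maximal cells
   are meaningful. *)
Record weighted_complex := WeightedComplex {
  cells : set (set 'rV[R]_n);
  mult : set 'rV[R]_n -> nat }.

Implicit Types S : weighted_complex.

Definition complex_support S : set 'rV[R]_n := \bigcup_(A in cells S) A.

Definition maximal_cell S A : Prop :=
  cells S A /\ forall B, cells S B -> A `<=` B -> B = A.

(* v avoids the finitely many proper subspaces for which some translates
   A and e v + B of cells could meet non-transversally for a small e > 0. *)
Definition generic S1 S2 : set 'rV[R]_n :=
  [set v | forall A B, cells S1 A -> cells S2 B ->
     (dimension (minkowski_sum A B) < n)%N ->
     v \notin (direction A + direction B)%VS].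

Definition stable_cells S1 S2 : set (set 'rV[R]_n) :=
  [set F | exists A B, [/\ cells S1 A, cells S2 B, A `&` B !=set0,
     dimension (minkowski_sum A B) = n & is_face (A `&` B) F]].

(* Pairs of maximal cells contributing to the weight of C, for the
   displacement v. *)
Definition meeting_pairs S1 S2 v (C : set 'rV[R]_n)
  : set (set 'rV[R]_n * set 'rV[R]_n) :=
  [set p | [/\ maximal_cell S1 p.1, maximal_cell S2 p.2,
     C `<=` p.1, C `<=` p.2 &
     \forall e \near 0^'+,
       p.1 `&` [set e *: v + y | y in p.2] !=set0]].

Definition stable_intersection S1 S2 : weighted_complex :=
  let v := get (generic S1 S2) in
  WeightedComplex (stable_cells S1 S2)
    (fun C => \big[addn/0%N]_(p \in meeting_pairs S1 S2 v C)
       (mult S1 p.1 * mult S2 p.2 *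
        lattice_index (lattice_sum (direction_lattice p.1)
                                   (direction_lattice p.2)))%N).

Definition stable_intersections k (S : 'I_k.+1 -> weighted_complex)
  : weighted_complex :=
  foldl stable_intersection (S ord0) [seq S (lift ord0 i) | i <- enum 'I_k].

End Geometry.

Section Hypersurface.
Variables (R : realType) (K : fieldType) (nu : K -> R) (n : nat).
Implicit Types (f : laurent K n) (w : 'rV[R]_n) (Q : set 'rV[R]_n).

(* The convex hull of the points (a, nu (f a)), for a an exponent of f. *)
Definition lifted_polytope f : set ('rV[R]_n * R^o) :=
  smallest (@convex_set R ('rV[R]_n * R^o)%type)
    [set (of_int R a, nu (f a)) | a in [set` finsupp f]].

Definition lower_face f w : set ('rV[R]_n * R^o) :=
  [set p | lifted_polytope f p /\ forall q, lifted_polytope f q ->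
     dot w p.1 + p.2 <= dot w q.1 + q.2].

Definition subdivision_cell f w : set 'rV[R]_n := fst @` lower_face f w.

(* The cells of the regular subdivision of the Newton polytope of f: the
   projections of the lower faces of the lifted polytope. *)
Definition regular_subdivision f : set (set 'rV[R]_n) :=
  range (subdivision_cell f).

Definition dual_cell f Q : set 'rV[R]_n := [set w | Q `<=` subdivision_cell f w].

Definition tropical_locus f : set 'rV[R]_n :=
  [set w | exists a b : 'rV[int]_n,
     [/\ a \in finsupp f, b \in finsupp f, a != b &
         forall c, c \in finsupp f ->
           nu (f a) + dot w (of_int R a) <= nu (f c) + dot w (of_int R c) /\
           nu (f b) + dot w (of_int R b) <= nu (f c) + dot w (of_int R c)]].

Definition is_hypersurface_of f (S : weighted_complex R n) : Prop :=
  [/\ complex_support S = tropical_locus f,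
      cells S = [set dual_cell f Q | Q in
        [set Q | regular_subdivision f Q /\ (0 < dimension Q)%N]] &
      forall Q, regular_subdivision f Q -> dimension Q = 1%N ->
        mult S (dual_cell f Q) = lattice_length Q].

Definition is_tropical_hypersurface (S : weighted_complex R n) : Prop :=
  exists f : laurent K n, finsupp f != fset0 /\ is_hypersurface_of f S.

End Hypersurface.

Section GeometryFacts.
Variables (R : realType) (n : nat).
Lemma dotDr (w x y : 'rV[R]_n) : dot w (x + y) = dot w x + dot w y.
Proof. by rewrite /dot -big_split; apply: eq_bigr => j _; rewrite mxE mulrDr. Qed.
Lemma dotZr (w x : 'rV[R]_n) c : dot w (c *: x) = c * dot w x.
Proof. by rewrite /dot mulr_sumr; apply: eq_bigr => j _; rewrite mxE mulrCA. Qed.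
Lemma of_int_inj : injective (@of_int R n).
Proof. by move=> a b /matrixP ab; apply/matrixP => i j; have := ab i j; rewrite !mxE => /intr_inj. Qed.

Lemma dimension_gt0P (A : set 'rV[R]_n) :
  (0 < dimension A)%N <-> exists x y, [/\ A x, A y & x != y].
Proof.
have [AU Umin] := lin_spanP (minkowski_diff A A).
split=> [d0|[x [y [Ax Ay xy]]]]; last first.
  rewrite /dimension lt0n dimv_eq0; apply: contra xy => /eqP U0.
  by rewrite -subr_eq0 -memv0 -U0; apply: AU; exists x => //; exists y.
apply/not_existsP => noxy; move: d0; rewrite lt0n dimv_eq0 -subv0 => /negP; apply.
apply: Umin => _ [x Ax [y Ay <-]]; rewrite memv0 subr_eq0.
by apply/negPn/negP => xy; apply: (noxy x); exists y.
Qed.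
End GeometryFacts.

Section HypersurfaceFacts.
Variables (R : realType) (K : fieldType) (nu : K -> R) (n : nat).
Implicit Types (f : laurent K n) (w : 'rV[R]_n) (Q : set 'rV[R]_n).

Let ht w (q : 'rV[R]_n * R^o) : R := dot w q.1 + q.2.
Let pt f (a : 'rV[int]_n) : 'rV[R]_n * R^o := (of_int R a, nu (f a)).

Lemma htA w (p q : 'rV[R]_n * R^o) (k : R) :
  ht w (k *: p + (1 - k) *: q) = k * ht w p + (1 - k) * ht w q.
Proof.
rewrite /ht /= dotDr !dotZr.
transitivity (k * dot w p.1 + (1 - k) * dot w q.1 + (k * p.2 + (1 - k) * q.2)) => //.
ring.
Qed.

Lemma hull_convex f (C : set ('rV[R]_n * R^o)) :
  (forall x y (k : R), 0 < k -> k < 1 -> C x -> C y -> C (k *: x + (1 - k) *: y)) ->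
  (forall a, a \in finsupp f -> C (pt f a)) ->
  lifted_polytope nu f `<=` C.
Proof.
move=> Cc Cf q; apply; split=> [|_ [a /= af <-]]; last exact: Cf.
apply/convex_setW => x y; rewrite !inE /= => cx cy l l0 l1.
by apply: mem_set; exact: (Cc x y (l%:num) l0 l1 cx cy).
Qed.

Lemma lower_pt f w a : a \in finsupp f ->
  (forall b, b \in finsupp f -> ht w (pt f a) <= ht w (pt f b)) ->
  lower_face nu f w (pt f a).
Proof.
move=> af amin; split.
  by move=> C [_ Cf]; apply: Cf; exists a.
apply: hull_convex => [x y k k0 k1 hx hy|b bf]; last exact: amin.
change (ht w (pt f a) <= ht w (k *: x + (1 - k) *: y)).
have hx' : ht w (pt f a) <= ht w x by [].
have hy' : ht w (pt f a) <= ht w y by [].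
rewrite htA; nra.
Qed.

Lemma lower_unique f w a :
  (forall b, b \in finsupp f -> b != a -> ht w (pt f a) < ht w (pt f b)) ->
  a \in finsupp f ->
  lower_face nu f w `<=` [set pt f a].
Proof.
move=> amin af p [pL pmin].
have paL : lifted_polytope nu f (pt f a) by move=> C [_ Cf]; apply: Cf; exists a.
have /(_ _ pL) [//|] : lifted_polytope nu f `<=`
    [set q | q = pt f a \/ ht w (pt f a) < ht w q].
  apply: hull_convex => [x y k k0 k1 /= hx hy|b bf /=]; last first.
    by have [->|/amin] := eqVneq b a; [left|move/(_ bf); right].
  case: hx => [->|hx]; case: hy => [->|hy].
  - by left; rewrite -scalerDl addrC subrK scale1r.
  - by right; rewrite htA; nra.
  - by right; rewrite htA; nra.
  - by right; rewrite htA; nra.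
by rewrite ltNge; move=> /negP; case; apply: (pmin _ paL).
Qed.

(* The clause on [complex_support] in [is_hypersurface_of] follows from the one on
   [cells]. *)
Lemma dual_support f : \bigcup_(A in [set dual_cell nu f Q | Q in
        [set Q | regular_subdivision nu f Q /\ (0 < dimension Q)%N]]) A
   = tropical_locus nu f.
Proof.
apply/seteqP; split=> w.
  move=> [_ [Q [_ /dimension_gt0P[x [y [Qx Qy xy]]]] <-] Qw].
  have [p pl px] := Qw _ Qx; have [q ql qy] := Qw _ Qy.
  have [/eqP f0|f0] := boolP (finsupp f == fset0).
    have : lifted_polytope nu f `<=` set0.
      by apply: hull_convex => // a; rewrite f0 inE.
    by move=> /(_ p) []; apply: pl.1.
  have [a0 a0f] := fset0Pn _ f0.
  pose i0 : finsupp f := FSetSub a0f.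
  have [i _ imin] := @arg_minP _ _ _ i0 predT (fun i => ht w (pt f (val i))) isT.
  have amin b : b \in finsupp f -> ht w (pt f (val i)) <= ht w (pt f b).
    by move=> bf; apply: (imin (FSetSub bf)).
  have [[b [bf ba bmin]]|no] := pselect (exists b, [/\ b \in finsupp f, b != val i
      & ht w (pt f b) <= ht w (pt f (val i))]).
    exists (val i), b; split=> //; first exact: valP.
      by rewrite eq_sym.
    move=> c cf; rewrite ![nu _ + _]addrC; split; first exact: amin.
    by apply: (le_trans bmin); apply: amin.
  suff L : lower_face nu f w `<=` [set pt f (val i)].
    by move: xy; rewrite -px -qy (L _ pl) (L _ ql) eqxx.
  apply: lower_unique; last exact: valP.
  move=> b bf ba; rewrite ltNge; apply/negP => h.
  by apply: no; exists b.
move=> [a [b [af bf ab abmin]]].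
exists (dual_cell nu f (subdivision_cell nu f w)) => //.
exists (subdivision_cell nu f w) => //; split; first by exists w.
apply/dimension_gt0P; exists (of_int R a), (of_int R b); split.
- exists (pt f a) => //; apply: lower_pt => // c cf; rewrite /ht/= addrC [leRHS]addrC.
  exact: (abmin c cf).1.
- exists (pt f b) => //; apply: lower_pt => // c cf; rewrite /ht/= addrC [leRHS]addrC.
  exact: (abmin c cf).2.
- by apply: contra ab => /eqP/of_int_inj ->.
Qed.

Lemma dual_inj f Q Q' : regular_subdivision nu f Q -> regular_subdivision nu f Q' ->
  dual_cell nu f Q = dual_cell nu f Q' -> Q = Q'.
Proof.
move=> [w _ <-] [w' _ <-] e; apply/seteqP; split.
  suff : dual_cell nu f (subdivision_cell nu f w) w' by [].
  by rewrite e.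
suff : dual_cell nu f (subdivision_cell nu f w') w by [].
by rewrite -e.
Qed.

Lemma hypersurface_exists f : exists S, is_hypersurface_of nu f S.
Proof.
pose Qof A : set 'rV[R]_n := get [set Q | regular_subdivision nu f Q /\ dual_cell nu f Q = A].
exists (WeightedComplex [set dual_cell nu f Q | Q in
        [set Q | regular_subdivision nu f Q /\ (0 < dimension Q)%N]]
   (fun A => lattice_length (Qof A))).
split=> //=; first exact: dual_support.
move=> Q rQ _; congr lattice_length.
rewrite /Qof; case: xgetP => [Q' _ [rQ' e]|/(_ Q) []//].
exact: (dual_inj rQ' rQ e).
Qed.
End HypersurfaceFacts.

Section GenericFacts.
Variables (R : realType) (n : nat).
Lemma avoid (I : eqType) (s : seq I) (U : I -> {vspace 'rV[R]_n}) :
  (forall i, i \in s -> U i != fullv) -> exists v, forall i, i \in s -> v \notin U i.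
Proof.
elim: s => [_|i s IH sU]; first by exists 0.
have [v hv] := IH (fun j js => sU j (mem_behead (s := i :: s) js)).
have [vi|vi] := boolP (v \in U i); last first.
  by exists v => j; rewrite inE => /orP[/eqP->|/hv].
have : ~~ (fullv <= U i)%VS.
  by apply: contra (sU i (mem_head _ _)); rewrite eqEsubv subvf => ->.
case/subvPn => u _ ui.
have bad j : exists c0 : R, j \in s -> forall c, u + c *: v \in U j -> c = c0.
  have [[c0 h0]|no] := pselect (exists c0, u + c0 *: v \in U j); last first.
    by exists 0 => _ c hc; exfalso; apply: no; exists c.
  exists c0 => js c hc; apply/eqP; rewrite -subr_eq0; apply/negPn/negP => cc.
  have /negP := hv j js; apply; rewrite -[v](scalerK cc); apply: memvZ.
  have -> : (c - c0) *: v = (u + c *: v) - (u + c0 *: v).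
    by rewrite scalerBl opprD addrACA subrr add0r.
  exact: rpredB.
have {bad}[c0 hc0] := choice bad.
pose c := 1 + \sum_(j <- s) `|c0 j|.
exists (u + c *: v) => j; rewrite inE => /orP[/eqP->|js].
  apply: contra ui => h; have := rpredB h (memvZ c vi); by rewrite addrK.
apply/negP => /(hc0 j js) e.
have : c0 j <= \sum_(j <- s) `|c0 j|.
  rewrite (big_rem j js) /=; apply: (le_trans (ler_norm _)).
  by rewrite lerDl sumr_ge0.
by rewrite -e /c; lra.
Qed.

(* [get (generic S1 S2)] is a generic vector for finite complexes with nonempty
   cells. *)
Lemma generic_exists (S1 S2 : weighted_complex R n) :
  finite_set (cells S1) -> finite_set (cells S2) ->
  ~ cells S1 set0 -> ~ cells S2 set0 -> generic S1 S2 !=set0.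
Proof.
move=> /finite_seqP[s1 e1] /finite_seqP[s2 e2] n1 n2.
pose s := [seq p <- [seq (A, B) | A <- s1, B <- s2] | (dimension (minkowski_sum p.1 p.2) < n)%N].
have [p|v hv] := @avoid _ s (fun p => direction p.1 + direction p.2)%VS.
  rewrite mem_filter => /andP[d /allpairsP[[A B] /= [As Bs pE]]].
  have A0 : A !=set0 by apply/set0P/eqP => A0; apply: n1; rewrite e1 /= -A0.
  have B0 : B !=set0 by apply/set0P/eqP => B0; apply: n2; rewrite e2 /= -B0.
  rewrite pE /= in d *; apply/eqP => f; move: d; rewrite ltnNge => /negP; apply.
  have dn : \dim (direction A + direction B)%VS = n by rewrite f dimvf /dim /= mul1n.
  rewrite -[X in (X <= _)%N]dn; apply: dimvS; rewrite subv_add.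
  have [a Aa] := A0; have [b Bb] := B0.
  have [hs _] := lin_spanP (minkowski_diff (minkowski_sum A B) (minkowski_sum A B)).
  apply/andP; split.
    apply: (lin_spanP (minkowski_diff A A)).2 => _ [x Ax [y Ay <-]].
    apply: hs; exists (x + b); first by exists x => //; exists b.
    by exists (y + b); [exists y => //; exists b|rewrite opprD addrACA subrr addr0].
  apply: (lin_spanP (minkowski_diff B B)).2 => _ [x Ax [y Ay <-]].
  apply: hs; exists (a + x); first by exists a => //; exists x.
  by exists (a + y); [exists a => //; exists y|rewrite opprD addrACA subrr add0r].
exists v => A B; rewrite e1 e2 /= => As Bs d; apply: (hv (A, B)).
by rewrite mem_filter d; apply/allpairsP; exists (A, B).
Qed.
End GenericFacts.

(* Main.v *)
Require Import Defs.
From HB Require Import structures.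
From mathcomp Require Import all_boot all_order all_algebra.
From mathcomp Require Import finmap.
From mathcomp Require Import mathcomp_extra boolp classical_sets functions.
From mathcomp Require Import cardinality fsbigop reals topology normedtype.
From mathcomp Require Import zify ring lra.
From mathcomp Require Import fintype finset.
Import Order.TTheory GRing.Theory Num.Theory.
Import numFieldNormedType.Exports.
Set Implicit Arguments.
Unset Strict Implicit.
Unset Printing Implicit Defensive.
Local Open Scope ring_scope.

(** At a point [x], a tropical polynomial has a set of active terms, those
    attaining the minimum, and [x] lies on the hypersurface when the differences
    of the active exponents span a nonzero space [V_i(x)].  A point is stable
    when one can choose vectors in [V_0(x)], ..., [V_k(x)] that are linearly
    independent; by Rado's theorem this means that any [m] of these spaces span
    at least [m] dimensions.

    A nonempty stable intersection provides, by the transversality conditions in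
    its definition, independent differences of exponents, one for each
    polynomial, though these need not be active at a common point
    ([stable_cells_independent]).  It is to be shown that under this global
    independence any point [w] of the intersection of the hypersurfaces can be
    joined to a stable point by a polygonal path in that intersection
    ([joinable_all]), and that stable points lie in the stable intersection
    ([flag_exists], [flag_stable_cell]).

    For the first claim, suppose that [w] is not stable.  Let [C] be a smallest
    subfamily whose active differences fall short of its size by the largest
    amount, and let [L] be their span.  The remaining hypersurfaces [J] are then
    independent modulo [L] at [w].  Within the affine space through [w]
    orthogonal to [L], the points where the active terms of [C] at [w] stay
    active form a polyhedron, contained in all members of [C].  By global
    independence some difference [u] of exponents of a member of [C] is
    independent of [J] and [L], and the choice can be made so that [u] is
    bounded below on this polyhedron.  Adding to [J] the hyperplane through [w]
    normal to [u] gives a smaller family; by induction a path leads to a point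
    where [J] and [u] are independent modulo [L], and from there [u] decreases
    without bound along the stable intersection of [J] ([descend]).  Hence the
    path leaves the polyhedron.  It does so transversally, so at the first exit
    the rank has increased ([leave_or_stay], [decrease_deficiency]).  Along the
    path no rank drops; in particular the path stays in the intersection of the
    hypersurfaces.

    For the second claim the cells of the iterated stable intersection have to be
    found one after the other, such that the intersection of the cells found so
    far keeps the expected dimension.  A small move that leaves the point stable
    makes the active differences span as few dimensions as there are
    hypersurfaces ([tight_perturbation]).  At such a point one chooses the cells
    of all hypersurfaces but the last by induction, and then an edge of the dual
    polytope of the last one that is transversal to them. *)

(** * Rado's rank condition for families of subspaces *)

Section RankCondition.
Variables (F : fieldType) (vT : vectType F) (I : finType).
Implicit Types (L X Y Z : {vspace vT}) (V : I -> {vspace vT}).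
Implicit Types (S M J : {set I}).

Definition join_span L V M : {vspace vT} := (L + \sum_(i in M) V i)%VS.

(** By the defect form of Rado's theorem, this is the condition under which one
    can choose vectors that are independent modulo [L], one from each of all
    but [d] members of the family.  Working with the rank condition instead of
    chosen vectors makes submodularity of the dimension available. *)
Definition deficiency_le d L V S : Prop :=
  forall M, M \subset S -> (\dim L + #|M| <= \dim (join_span L V M) + d)%N.

Lemma join_spanS L L' V V' M : (L <= L')%VS ->
  (forall i, i \in M -> (V i <= V' i)%VS) ->
  (join_span L V M <= join_span L' V' M)%VS.
Proof.
move=> LL VV; rewrite /join_span subv_add (subv_trans LL (addvSl _ _)) /=.
by apply/subv_sumP => i iM; apply: subv_trans (addvSr _ _); apply: sumv_sup iM (VV _ iM).
Qed.

Lemma join_span_ge L V M : (L <= join_span L V M)%VS.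
Proof. exact: addvSl. Qed.

Lemma join_span_sup L V M i : i \in M -> (V i <= join_span L V M)%VS.
Proof. by move=> iM; apply: subv_trans (addvSr _ _); apply: sumv_sup iM (subvv _). Qed.

Lemma join_span_le L V M X : (L <= X)%VS -> (forall i, i \in M -> (V i <= X)%VS) ->
  (join_span L V M <= X)%VS.
Proof. by move=> LX VX; rewrite /join_span subv_add LX; apply/subv_sumP. Qed.

Lemma join_spanT L V M M' : M \subset M' -> (join_span L V M <= join_span L V M')%VS.
Proof.
move=> /subsetP s; apply: join_span_le; first exact: join_span_ge.
by move=> i /s; apply: join_span_sup.
Qed.

Lemma join_spanU L V M M' :
  join_span (join_span L V M) V M' = join_span L V (M :|: M').
Proof.
apply: subv_anti; apply/andP; split; last first.
  apply: join_span_le; first exact: subv_trans (join_span_ge _ _ _) (join_span_ge _ _ _).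
  move=> i; rewrite inE => /orP[iM|iM]; last exact: join_span_sup.
  exact: subv_trans (join_span_sup _ _ iM) (join_span_ge _ _ _).
apply: join_span_le; first by apply: join_spanT; apply: subsetUl.
by move=> i iM; apply: join_span_sup; rewrite inE iM orbT.
Qed.

Lemma join_span0 L V : join_span L V set0 = L.
Proof. by rewrite /join_span big_set0 addv0. Qed.

Lemma dimv_modular X Y Z : (X <= Y)%VS -> (\dim (Y + Z) + \dim X <= \dim (X + Z) + \dim Y)%N.
Proof.
move=> XY; have := dimv_sum_cap Y Z; have := dimv_sum_cap X Z.
have : (\dim (X :&: Z) <= \dim (Y :&: Z))%N by apply/dimvS/capvS.
by lia.
Qed.

Lemma deficiency_leV d L V V' S : (forall i, i \in S -> (V i <= V' i)%VS) ->
  deficiency_le d L V S -> deficiency_le d L V' S.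
Proof.
move=> VV dV M MS; apply: leq_trans (dV M MS) _; rewrite leq_add2r; apply/dimvS.
by apply: join_spanS => // i iM; apply: VV; apply: (subsetP MS).
Qed.

Lemma deficiency_leS d L V S S' : S' \subset S ->
  deficiency_le d L V S -> deficiency_le d L V S'.
Proof. by move=> s dV M MS; apply: dV; apply: subset_trans MS s. Qed.

(** Independence modulo a subspace implies independence modulo a smaller one:
    adding [V_M] to a smaller space gains at least as many dimensions. *)
Lemma deficiency_le_base X Y V S : (X <= Y)%VS ->
  deficiency_le 0 Y V S -> deficiency_le 0 X V S.
Proof.
move=> XY dV M MS; have := dV M MS; have := dimv_modular (\sum_(i in M) V i)%VS XY.
by rewrite /join_span; lia.
Qed.

Lemma dim_join_span_ge X Y V S : (X <= Y)%VS -> deficiency_le 0 Y V S ->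
  forall M, M \subset S -> (\dim X + #|M| <= \dim (join_span X V M))%N.
Proof. by move=> XY /(deficiency_le_base XY) h M /h; rewrite addn0. Qed.

Lemma deficiency_le_set1 L V i : deficiency_le 0 L V [set i] <-> ~~ (V i <= L)%VS.
Proof.
split=> [h|nle M].
  apply/negP => le; have := h [set i] (subxx _).
  by rewrite cards1 /join_span big_set1 (addv_idPl le) addn0 addn1 ltnn.
rewrite subset1 => /orP[/eqP->|/eqP->]; last by rewrite cards0 join_span0.
rewrite cards1 addn0 addn1 /join_span big_set1 ltnNge; apply: contra nle => le.
by apply/addv_idPl/eqP; rewrite eq_sym eqEdim addvSl.
Qed.

Lemma dimv_add_line L u : u \notin L -> \dim (L + <[u]>) = (\dim L).+1.
Proof.
move=> uL; have u0 : u != 0 by apply: contra uL => /eqP->; exact: mem0v.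
rewrite dimv_disjoint_sum ?dim_vline ?u0 ?addn1//; apply/eqP; rewrite -subv0.
apply/subvP => v /memv_capP[vL /vlineP[c cE]]; rewrite memv0 cE scaler_eq0 (negbTE u0) orbF.
apply: contraNT uL => c0; rewrite -[u](scalerK c0); apply: memvZ; by rewrite -cE.
Qed.

Lemma deficiency_le_add1 L u V S : u \notin L ->
  deficiency_le 0 (L + <[u]>)%VS V S ->
  forall M, M \subset S -> ((\dim L).+1 + #|M| <= \dim (join_span (L + <[u]>)%VS V M))%N.
Proof. by move=> uL h M MS; have := h M MS; rewrite dimv_add_line// addn0. Qed.

(** The exchange step of Rado's theorem.  The subfamilies on which the rank condition is an
    equality are closed under union, by submodularity of the dimension.  If no
    vector of [U] could be adjoined, then all of [U] would lie in the span of
    one such subfamily. *)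
Lemma adjoin_vector L V J (U : seq vT) : deficiency_le 0 L V J ->
  (forall M, M \subset J -> (\dim L + #|M| < \dim (join_span (L + <<U>>) V M))%N) ->
  exists u, [/\ u \in U, u \notin L & deficiency_le 0 (L + <[u]>)%VS V J].
Proof.
move=> hJ hU; apply: contrapT => no.
have tight1 u : u \in U -> exists M, [/\ M \subset J, u \in join_span L V M &
    \dim (join_span L V M) = (\dim L + #|M|)%N].
  move=> uU; have [uL|uL] := boolP (u \in L).
    by exists set0; rewrite sub0set join_span0 cards0 addn0.
  have /existsNP[M /not_implyP[MJ /negP]] : ~ deficiency_le 0 (L + <[u]>)%VS V J.
    by move=> h; apply: no; exists u.
  rewrite dimv_add_line// addn0 -ltnNge => ltM.
  have sub : (join_span L V M <= join_span (L + <[u]>)%VS V M)%VS.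
    by apply: join_spanS => //; apply: addvSl.
  have := hJ M MJ; have := dimvS sub; rewrite addn0 => le1 le2.
  exists M; split=> //; last by lia.
  have /eqP-> : join_span L V M == join_span (L + <[u]>)%VS V M.
    by rewrite eqEdim sub /=; lia.
  by rewrite memvE; apply: subv_trans (join_span_ge _ _ _); apply: addvSr.
have [M [MJ UM tM]] : exists M, [/\ M \subset J, {subset U <= join_span L V M} &
    \dim (join_span L V M) = (\dim L + #|M|)%N].
  elim: U tight1 {hU no} => [|u U IH] t1.
    by exists set0; rewrite sub0set join_span0 cards0 addn0; split.
  have [M1 [M1J UM1 t1M]] := IH (fun v vU => t1 v (mem_behead (s := u :: U) vU)).
  have [M2 [M2J uM2 t2M]] := t1 u (mem_head _ _).
  exists (M1 :|: M2); split; first by rewrite subUset M1J.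
    move=> v; rewrite inE => /orP[/eqP->|/UM1].
      by move: uM2; apply/subvP/join_spanT/subsetUr.
    by apply/subvP/join_spanT/subsetUl.
  have := hJ (M1 :|: M2); rewrite subUset M1J M2J => /(_ isT).
  have := hJ (M1 :&: M2) (subset_trans (subsetIl _ _) M1J).
  have capS : (join_span L V (M1 :&: M2) <=
      join_span L V M1 :&: join_span L V M2)%VS.
    by rewrite subv_cap !join_spanT ?subsetIl ?subsetIr.
  have sumS : (join_span L V (M1 :|: M2) <= join_span L V M1 + join_span L V M2)%VS.
    apply: join_span_le; first exact: subv_trans (join_span_ge _ _ _) (addvSl _ _).
    move=> i; rewrite inE => /orP[iM|iM].
      exact: subv_trans (join_span_sup _ _ iM) (addvSl _ _).
    exact: subv_trans (join_span_sup _ _ iM) (addvSr _ _).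
  have := dimvS capS; have := dimvS sumS; have := dimv_sum_cap (join_span L V M1) (join_span L V M2).
  have := cardsUI M1 M2; lia.
have := hU M MJ; rewrite -tM ltnNge => /negP; apply; apply/dimvS.
apply: join_span_le; last by move=> i; apply: join_span_sup.
by rewrite subv_add join_span_ge /=; apply/span_subvP.
Qed.

(** Take a subfamily of least cardinality among those of largest deficiency:
    if the remaining members were dependent modulo its span, they would
    increase its deficiency. *)
Lemma critical_subfamily d L V S : deficiency_le d.+1 L V S -> ~ deficiency_le d L V S ->
  exists J, [/\ J \subset S, (\dim L + #|J| = \dim (join_span L V J) + d.+1)%N,
    deficiency_le 0 (join_span L V J) V (S :\: J) &
    forall M, M \proper J -> (\dim L + #|M| <= \dim (join_span L V M) + d)%N].
Proof.
move=> hS /existsNP[M0 /not_implyP[M0S /negP bad0]].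
pose bad (M : {set I}) := (M \subset S) && ~~ (\dim L + #|M| <= \dim (join_span L V M) + d)%N.
have bad0' : bad M0 by rewrite /bad M0S.
case: (arg_minnP (fun M : {set I} => #|M|) bad0') => J /andP[JS badJ] Jmin.
have eJ : (\dim L + #|J| = \dim (join_span L V J) + d.+1)%N.
  by have := hS J JS; lia.
exists J; split=> //.
  move=> M; rewrite subsetD => /andP[MS MJ]; rewrite join_spanU.
  have := hS (J :|: M); rewrite subUset JS MS => /(_ isT).
  have := cardsUI J M; rewrite (setIC J) (disjoint_setI0 MJ) cards0; lia.
move=> M MJ; rewrite leqNgt; apply/negP => lt.
have : bad M.
  rewrite /bad (subset_trans (proper_sub MJ) JS) /=; lia.
by move=> /Jmin; have := proper_card MJ; lia.
Qed.

Lemma deficiency_leU1 L V S i u : i \notin S -> V i = <[u]>%VS -> u \notin join_span L V S ->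
  deficiency_le 0 L V S -> deficiency_le 0 L V (i |: S).
Proof.
move=> iS Vi uS hS M MiS.
have MS : M :\ i \subset S by rewrite subDset.
have [iM|iM] := boolP (i \in M); last first.
  apply: hS; apply/subsetP => j jM; have := subsetP MiS _ jM; rewrite in_setU1.
  by move=> /orP[/eqP ji|//]; rewrite -ji jM in iM.
have uM : u \notin join_span L V (M :\ i) by apply: contra uS; apply/subvP/join_spanT.
have le : (join_span L V (M :\ i) + <[u]> <= join_span L V M)%VS.
  rewrite subv_add -Vi (join_span_sup _ _ iM) andbT; apply: join_spanT; exact: subsetDl.
have := dimvS le; have := hS _ MS; rewrite (dimv_add_line uM) (cardsD1 i M) iM; lia.
Qed.

End RankCondition.

(** * Orthogonality *)

Section Orthogonality.
Variables (R : realType) (n : nat).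
Implicit Types (x y u v w : 'rV[R]_n) (U L : {vspace 'rV[R]_n}).

Lemma dotC x y : dot x y = dot y x.
Proof. by apply: eq_bigr => j _; rewrite mulrC. Qed.

Lemma dotDl x y u : dot (x + y) u = dot x u + dot y u.
Proof. by rewrite ![dot _ u]dotC dotDr. Qed.

Lemma dotZl c x u : dot (c *: x) u = c * dot x u.
Proof. by rewrite ![dot _ u]dotC dotZr. Qed.

Lemma dotNl x u : dot (- x) u = - dot x u.
Proof. by rewrite -scaleN1r dotZl mulN1r. Qed.

Lemma dotBl x y u : dot (x - y) u = dot x u - dot y u.
Proof. by rewrite dotDl dotNl. Qed.

Lemma dotBr x y u : dot u (x - y) = dot u x - dot u y.
Proof. by rewrite ![dot u _]dotC dotBl. Qed.

Lemma dot0l u : dot 0 u = 0.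
Proof. by rewrite -(scale0r u) dotZl mul0r. Qed.

Lemma dot0r u : dot u 0 = 0.
Proof. by rewrite dotC dot0l. Qed.

Definition orthogonal_to v U : Prop := forall u, u \in U -> dot v u = 0.

Lemma orthogonalS v U L : (L <= U)%VS -> orthogonal_to v U -> orthogonal_to v L.
Proof. by move=> /subvP s o u /s; apply: o. Qed.

Lemma orthogonal_add v U L : orthogonal_to v U -> orthogonal_to v L -> orthogonal_to v (U + L)%VS.
Proof. by move=> oU oL _ /memv_addP[a aU [b bL ->]]; rewrite dotDr oU// oL// addr0. Qed.

Lemma orthogonal_line v u : dot v u = 0 -> orthogonal_to v <[u]>%VS.
Proof. by move=> h _ /vlineP[c ->]; rewrite dotZr h mulr0. Qed.

Lemma orthogonalD v w U : orthogonal_to v U -> orthogonal_to w U -> orthogonal_to (v + w) U.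
Proof. by move=> ov ow u uU; rewrite dotDl ov// ow// addr0. Qed.

Lemma orthogonalZ c v U : orthogonal_to v U -> orthogonal_to (c *: v) U.
Proof. by move=> ov u uU; rewrite dotZl ov// mulr0. Qed.

Lemma orthogonalN v U : orthogonal_to v U -> orthogonal_to (- v) U.
Proof. by move=> ov u uU; rewrite dotNl ov// oppr0. Qed.

Lemma orthogonal0 U : orthogonal_to 0 U.
Proof. by move=> u _; rewrite dot0l. Qed.

Lemma orthogonal_sum (I : finType) (P : pred I) (V : I -> {vspace 'rV[R]_n}) v :
  (forall i, P i -> orthogonal_to v (V i)) -> orthogonal_to v (\sum_(i | P i) V i)%VS.
Proof.
move=> h u /memv_sumP[w wV ->].
elim/big_rec: _ => [|i x Pi IH]; first by rewrite dot0r.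
by rewrite dotDr (h i Pi _ (wV i Pi)) add0r.
Qed.

Lemma exists_orthogonal U u : u \notin U ->
  exists v, orthogonal_to v U /\ dot v u = 1.
Proof.
move=> uU; pose M := \matrix_(i < \dim U) tnth (vbasis U) i.
have rowM i : row i M = tnth (vbasis U) i by rewrite rowK.
have : ~~ (u <= M)%MS.
  apply: contra uU => /submxP[y ->]; rewrite mulmx_sum_row; apply: memv_suml => i _.
  by apply: memvZ; rewrite rowM; apply: vbasis_mem; apply: mem_tnth.
rewrite submxE => nz.
have [j dj] : exists j, (u *m cokermx M) 0 j != 0.
  apply: contrapT => no; move: nz => /negP; apply; apply/eqP/rowP => j.
  by rewrite !mxE; apply: contrapT => /eqP h; apply: no; exists j; rewrite mxE.
pose d := (col j (cokermx M))^T.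
have dE x : dot d x = (x *m cokermx M) 0 j.
  by rewrite /dot !mxE; apply: eq_bigr => k _; rewrite !mxE mulrC.
exists (((u *m cokermx M) 0 j)^-1 *: d); split; last by rewrite dotZl dE mulVf.
apply: orthogonalZ => x xU; rewrite dE.
rewrite (coord_vbasis xU) mulmx_suml summxE big1// => i _.
rewrite -scalemxAl !mxE.
have -> : \sum_k ((vbasis U)`_i) 0 k * cokermx M k j = (row i (M *m cokermx M)) 0 j.
  rewrite row_mul mxE; apply: eq_bigr => k _; congr (_ * _); rewrite rowM (tnth_nth 0) //.
by rewrite mulmx_coker !mxE mulr0.
Qed.

End Orthogonality.

(** * Active terms of tropical polynomials *)

Section Active.
Variables (R : realType) (n : nat) (T : finType) (ex : T -> 'rV[R]_n).
Implicit Types (A B : {set T}) (h : T -> R) (x y v w : 'rV[R]_n) (a b c : T).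
Implicit Types (U : {vspace 'rV[R]_n}).

Definition term_value h x c : R := h c + dot x (ex c).

(** A tropical polynomial is given by its set of terms [A] and its coefficients
    [h]; the exponents [ex] are fixed once and for all, so that new systems are
    obtained by changing [A] and [h] only. *)
Definition active A h x : {set T} :=
  [set a in A | [forall c in A, term_value h x a <= term_value h x c]].

Lemma activeP A h x a : reflect
  (a \in A /\ forall c, c \in A -> term_value h x a <= term_value h x c)
  (a \in active A h x).
Proof.
rewrite inE; apply: (iffP andP) => -[aA H]; split=> //.
  by move=> c cA; move/forall_inP: H; apply.
by apply/forall_inP.
Qed.

Lemma active_sub A h x : active A h x \subset A.
Proof. by apply/subsetP => a /activeP[]. Qed.

Lemma active_eq A h x a b : a \in active A h x -> b \in active A h x ->
  term_value h x a = term_value h x b.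
Proof.
by move=> /activeP[aA amin] /activeP[bA bmin]; apply/le_anti; rewrite amin// bmin.
Qed.

Lemma active_lt A h x a b : a \in active A h x -> b \in A -> b \notin active A h x ->
  term_value h x a < term_value h x b.
Proof.
move=> aa bA; apply: contraNT; rewrite -leNgt => ba; apply/activeP; split=> // c cA.
by apply: le_trans ba _; have /activeP[_] := aa; apply.
Qed.

Lemma active_of_le A h x a b : a \in active A h x -> b \in A ->
  term_value h x b <= term_value h x a -> b \in active A h x.
Proof.
by move=> aa bA ba; apply: contraLR ba => /(active_lt aa bA); rewrite -ltNge.
Qed.

Lemma active_nonempty A h x a : a \in A -> exists b, b \in active A h x.
Proof.
move=> aA.
have [b bA bmin] := @Order.TotalTheory.arg_minP _ _ _ a (mem A) (term_value h x) aA.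
by exists b; apply/activeP; split.
Qed.

Lemma term_valueD h x v s c : term_value h (x + s *: v) c = term_value h x c + s * dot v (ex c).
Proof. by rewrite /term_value dotDl dotZl; ring. Qed.

(** The direction space of the convex hull of the exponents in [B].  For the
    terms active at [x] it is nonzero precisely when [x] lies on the tropical
    hypersurface, and orthogonal to the cell that has [x] in its relative
    interior. *)
Definition dir_span B : {vspace 'rV[R]_n} :=
  (\sum_(a in B) \sum_(b in B) <[ex a - ex b]>)%VS.

Lemma dir_spanP B U :
  reflect (forall a b, a \in B -> b \in B -> ex a - ex b \in U) (dir_span B <= U)%VS.
Proof.
apply: (iffP subv_sumP) => H; first by move=> a b aB bB; have /subv_sumP/(_ b bB) := H a aB.
by move=> a aB; apply/subv_sumP => b bB; rewrite -memvE H.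
Qed.

Lemma mem_dir_span B a b : a \in B -> b \in B -> ex a - ex b \in dir_span B.
Proof. by move=> aB bB; have /dir_spanP := subvv (dir_span B); apply. Qed.

Lemma dir_spanS A B : A \subset B -> (dir_span A <= dir_span B)%VS.
Proof. by move=> /subsetP s; apply/dir_spanP => a b /s aB /s bB; apply: mem_dir_span. Qed.

Lemma orthogonal_dir_span B v :
  (forall a b, a \in B -> b \in B -> dot v (ex a) = dot v (ex b)) -> orthogonal_to v (dir_span B).
Proof.
move=> h; apply: orthogonal_sum => a aB; apply: orthogonal_sum => b bB.
by apply: orthogonal_line; rewrite dotBr (h a b)// subrr.
Qed.

Lemma orthogonal_dir_spanE B v a b : orthogonal_to v (dir_span B) -> a \in B -> b \in B ->
  dot v (ex a) = dot v (ex b).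
Proof. by move=> o aB bB; apply/eqP; rewrite -subr_eq0 -dotBr o// mem_dir_span. Qed.

Lemma orthogonal_common_active A h x y :
  orthogonal_to (y - x) (dir_span (active A h x :&: active A h y)).
Proof.
apply: orthogonal_dir_span => a b; rewrite !inE -!andbA.
move=> /and4P[aA ax _ ay] /and4P[bA bx _ _by].
have := @active_eq A h x a b; have := @active_eq A h y a b.
rewrite !inE aA ax ay bA bx _by => /(_ isT isT) + /(_ isT isT).
rewrite /term_value !dotBl; lra.
Qed.

Lemma active_convex A h x y s : 0 <= s -> s <= 1 ->
  active A h x :&: active A h y \subset active A h (x + s *: (y - x)).
Proof.
move=> s0 s1; apply/subsetP => a; rewrite inE => /andP[/activeP[aA ax] /activeP[_ ay]].
apply/activeP; split=> // c cA; have := ax c cA; have := ay c cA.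
rewrite /term_value !dotDl !dotZl !dotDl !dotNl; nra.
Qed.

Lemma active_move A h x v s B b : b \in B -> B \subset active A h x ->
  orthogonal_to v (dir_span B) ->
  (forall c, c \in A -> term_value h (x + s *: v) b <= term_value h (x + s *: v) c) ->
  B \subset active A h (x + s *: v).
Proof.
move=> bB BA o le; apply/subsetP => a aB.
have aa := subsetP BA _ aB; have ba := subsetP BA _ bB.
apply/activeP; split; first by case/activeP: aa.
move=> c cA; rewrite (le_trans _ (le c cA))// !term_valueD (active_eq aa ba).
by rewrite (orthogonal_dir_spanE o aB bB).
Qed.

(** Locally at [x] a tropical polynomial behaves like the homogeneous one formed
    by its active terms with coefficients zero: after a short move along [v]
    the active terms of the latter at [v] are active. *)
Lemma active_perturb A h x v :
  exists e, 0 < e /\ forall s, 0 < s -> s <= e ->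
    active (active A h x) (fun=> 0) v \subset active A h (x + s *: v) /\
    active A h (x + s *: v) \subset active A h x.
Proof.
(* the length up to which the value of the term [a] stays below that of [c] *)
pose gap a c : R := if a \in active A h x then
  if (c \in A) && (c \notin active A h x) then
    (term_value h x c - term_value h x a) / (`|dot v (ex c) - dot v (ex a)| + 1) else 1 else 1.
have gap0 a c : 0 < gap a c.
  rewrite /gap; case: ifP => // aa; case: ifP => // /andP[cA ca].
  by apply: divr_gt0; [rewrite subr_gt0 (active_lt aa)|rewrite ltr_wpDl].
pose e := \big[Num.min/1]_(p : T * T) gap p.1 p.2.
have e0 : 0 < e.
  by rewrite /e; elim/big_rec: _ => // p y _ y0; rewrite lt_min gap0.
have eP a c : e <= gap a c.
  by rewrite /e (bigD1 (a, c)) //= ge_min lexx.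
have key s a c : 0 < s -> s <= e / 2 -> a \in active A h x -> c \in A ->
    c \notin active A h x -> term_value h (x + s *: v) a < term_value h (x + s *: v) c.
  move=> s0 se aa cA ca; have := eP a c; rewrite /gap aa cA ca /= => he.
  have d0 : 0 < `|dot v (ex c) - dot v (ex a)| + 1 by rewrite ltr_wpDl.
  move: he; rewrite ler_pdivlMr// => he.
  rewrite !term_valueD.
  have := ler_norm (- (dot v (ex c) - dot v (ex a))); rewrite normrN => hn.
  have n0 := normr_ge0 (dot v (ex c) - dot v (ex a)).
  have gp := active_lt aa cA ca.
  move: (term_value h x a) (term_value h x c) gp he hn n0 d0 => ta tc.
  move: (dot v (ex a)) (dot v (ex c)) => da dc; move: `|_| => N gp he hn n0 d0.
  nra.
exists (e / 2); split; first by rewrite divr_gt0.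
move=> s s0 se; split; apply/subsetP => a.
  move=> /activeP[aa amin]; apply/activeP; split; first by case/activeP: aa.
  move=> c cA; have [ca|ca] := boolP (c \in active A h x); last exact/ltW/key.
  rewrite !term_valueD (active_eq aa ca) lerD2l ler_pM2l//.
  by have := amin c ca; rewrite /term_value !add0r.
move=> am; have aA := subsetP (active_sub _ _ _) _ am.
have [b ba] := active_nonempty h x aA.
apply: contraT => aa; have := key s b a s0 se ba aA aa.
by rewrite ltNge; case/activeP: am => _ ->//; apply: subsetP (active_sub _ _ _) _ ba.
Qed.

End Active.

(** * Paths in intersections of tropical hypersurfaces *)

Inductive reach (X : Type) (step : X -> X -> Prop) (x : X) : X -> Prop :=
| reach_refl : reach step x x
| reach_step y z : reach step x y -> step y z -> reach step x z.

Lemma reach_trans (X : Type) (step : X -> X -> Prop) x y z :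
  reach step x y -> reach step y z -> reach step x z.
Proof. by move=> xy; elim=> // u v _ xu uv; apply: reach_step uv. Qed.

Lemma reach_sub (X : Type) (step step' : X -> X -> Prop) x y :
  (forall u v, step u v -> step' u v) -> reach step x y -> reach step' x y.
Proof. by move=> s; elim=> [|u v _ xu uv]; [exact: reach_refl|apply: reach_step (s _ _ uv)]. Qed.

Section Paths.
Variables (R : realType) (n : nat) (I T : finType) (ex : T -> 'rV[R]_n).
Implicit Types (A : I -> {set T}) (h : I -> T -> R) (x y z v w u : 'rV[R]_n).
Implicit Types (L : {vspace 'rV[R]_n}) (S J C M : {set I}).

Local Notation active := (active ex).
Local Notation dir_span := (dir_span ex).
Local Notation term_value := (term_value ex).

Definition global_span A (i : I) := dir_span (A i).

Definition local_span A h x (i : I) := dir_span (active (A i) (h i) x).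

(** Terms active at both ends are active along the whole segment, by
    [active_convex].  Conditions on these spans therefore hold at every point
    of the segment. *)
Definition segment_span A h x y (i : I) :=
  dir_span (active (A i) (h i) x :&: active (A i) (h i) y).

Lemma local_global_span A h x i : (local_span A h x i <= global_span A i)%VS.
Proof. exact/dir_spanS/active_sub. Qed.

Lemma segment_local_span A h x y i : (segment_span A h x y i <= local_span A h y i)%VS.
Proof. exact/dir_spanS/subsetIr. Qed.

Lemma segment_spanS A h x y z i :
  active (A i) (h i) x :&: active (A i) (h i) z \subset active (A i) (h i) y ->
  (segment_span A h x z i <= segment_span A h x y i)%VS.
Proof. by move=> s; apply: dir_spanS; rewrite subsetI subsetIl. Qed.

Lemma orthogonal_segment_span A h x y i : orthogonal_to (y - x) (segment_span A h x y i).
Proof. exact: orthogonal_common_active. Qed.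

Definition rigid_step A h L J x y : Prop :=
  orthogonal_to (y - x) L /\ deficiency_le 0 L (segment_span A h x y) J.

(** For [L = 0] and singletons [M] the condition says that the segment stays in
    every hypersurface through the base point [w]. *)
Definition monotone_step A h L S w x y : Prop :=
  orthogonal_to (y - x) L /\ forall M, M \subset S ->
    deficiency_le 0 L (local_span A h w) M ->
    deficiency_le 0 L (segment_span A h x y) M.

Lemma reach_monotone_local A h L S w x : reach (monotone_step A h L S w) w x ->
  forall M, M \subset S -> deficiency_le 0 L (local_span A h w) M ->
    deficiency_le 0 L (local_span A h x) M.
Proof.
elim=> // y z _ _ [_ yz] M MS Mw; apply: deficiency_leV (yz M MS Mw).
by move=> i _; apply: segment_local_span.
Qed.

Lemma term_exists_of_deficiency L (V : I -> {vspace 'rV[R]_n}) J i (B : {set T}) :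
  deficiency_le 0 L V J -> i \in J -> V i = dir_span B -> exists b, b \in B.
Proof.
move=> hJ iJ Vi; apply: contrapT => no.
have B0 : B = set0.
  by apply/setP => c; rewrite in_set0; apply/negP => cB; apply: no; exists c.
have := hJ [set i]; rewrite sub1set iJ cards1 => /(_ isT).
rewrite /join_span big_set1 Vi B0.
have -> : dir_span set0 = 0%VS.
  by apply/eqP; rewrite -subv0; apply/dir_spanP => a b; rewrite inE.
by rewrite addv0; lia.
Qed.

(** The path leaves transversally.  The terms of [C] active at [w] tie along the
    path, so at the first point where another term becomes active, its
    difference [e] to the others is not orthogonal to the segment, while [L0]
    and the spans of [J] along the segment are.  Hence [J] is even independent
    modulo [L0 + <[e]>]. *)
Lemma leave_or_stay A h L0 C J w z :
  (forall i, i \in C -> (local_span A h w i <= L0)%VS) ->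
  (forall i, i \in C -> exists b, b \in active (A i) (h i) w) ->
  reach (rigid_step A h L0 J) w z ->
  let stay x y := rigid_step A h L0 J x y /\ forall i, i \in C ->
    active (A i) (h i) w \subset active (A i) (h i) x :&: active (A i) (h i) y in
  (reach stay w z /\ forall i, i \in C -> active (A i) (h i) w \subset active (A i) (h i) z) \/
  exists y e i, [/\ reach stay w y,
    forall j, j \in C -> active (A j) (h j) w \subset active (A j) (h j) y,
    i \in C /\ e \in local_span A h y i, e \notin L0 &
    deficiency_le 0 (L0 + <[e]>)%VS (local_span A h y) J].
Proof.
move=> CL Cb wz stay; elim: wz => [|x {}z _ IH [oxz dxz]].
  by left; split; [exact: reach_refl|move=> i _; exact: subxx].
case: IH => [[wx Cx]|]; last by right.
pose v := z - x.
have zE : z = x + 1 *: v by rewrite scale1r addrC subrK.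
pose bad (p : I * T * T) := [&& p.1.1 \in C, p.1.2 \in active (A p.1.1) (h p.1.1) w,
  p.2 \in A p.1.1 & term_value (h p.1.1) z p.2 < term_value (h p.1.1) z p.1.2].
have orthC i : i \in C -> orthogonal_to v (dir_span (active (A i) (h i) w)).
  by move=> iC; apply: orthogonalS (CL i iC) oxz.
have [[p0 bad0]|nobad] := pselect (exists p, bad p); last first.
  have Cz i : i \in C -> active (A i) (h i) w \subset active (A i) (h i) z.
    move=> iC; have [b bw] := Cb i iC; rewrite zE.
    apply: (active_move bw (Cx i iC) (orthC i iC)) => c cA; rewrite -zE leNgt.
    by apply/negP => lt; apply: nobad; exists (i, b, c); rewrite /bad /= iC bw cA.
  left; split=> //; apply: (reach_step wx); split; first by split.
  by move=> i iC; rewrite subsetI Cx// Cz.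
pose al (p : I * T * T) := term_value (h p.1.1) x p.2 - term_value (h p.1.1) x p.1.2.
pose be (p : I * T * T) := term_value (h p.1.1) z p.2 - term_value (h p.1.1) z p.1.2.
(* the parameter at which the term [c] reaches the value of [b] *)
pose cr p := al p / (al p - be p).
have badP p : bad p -> 0 <= al p /\ be p < 0.
  case: p => [[i b] c] /and4P[/= iC bw cA lt]; rewrite /al /be /=; split; last by lra.
  have /activeP[_ bm] := subsetP (Cx i iC) _ bw; have := bm c cA; lra.
have [p badp pmin] := @Order.TotalTheory.arg_minP _ _ _ p0 bad cr bad0.
have [al0 be0] := badP p badp.
pose s := cr p; pose y := x + s *: v.
have ab0 : 0 < al p - be p by lra.
have s0 : 0 <= s by rewrite /s /cr divr_ge0// ltW.
have s1 : s <= 1 by rewrite /s /cr ler_pdivrMr//; lra.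
have yE i c : term_value (h i) y c =
    (1 - s) * term_value (h i) x c + s * term_value (h i) z c.
  by rewrite {1}zE !term_valueD; ring.
right; case: p badp pmin al0 be0 @s @y ab0 s0 s1 yE => [[i b] c] badp pmin al0 be0 s y ab0 s0 s1 yE.
have /and4P[/= iC bw cA lt] := badp.
have Cy j : j \in C -> active (A j) (h j) w \subset active (A j) (h j) y.
  move=> jC; have [b' bw'] := Cb j jC.
  apply: (active_move bw' (Cx j jC) (orthC j jC)) => c' cA'; rewrite -/y !yE.
  have /activeP[_ bm] := subsetP (Cx j jC) _ bw'; have := bm c' cA' => hx.
  have [hz|hz] := leP (term_value (h j) z b') (term_value (h j) z c'); first by nra.
  have badq : bad (j, b', c') by rewrite /bad /= jC bw' cA'.
  have := pmin _ badq; have [] := badP _ badq; rewrite -/s /cr /al /be /= => q1 q2.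
  rewrite ler_pdivlMr; last by lra.
  nra.
have cy : c \in active (A i) (h i) y.
  apply: (active_of_le (subsetP (Cy i iC) _ bw) cA); rewrite !yE.
  have : s * (al (i, b, c) - be (i, b, c)) = al (i, b, c) by rewrite /s /cr divfK// gt_eqF.
  rewrite /al /be /=; nra.
pose e := ex c - ex b.
have ve : dot v e != 0.
  have -> : dot v e = be (i, b, c) - al (i, b, c).
    by rewrite /be /al /= /term_value /e /v !dotBl !dotBr; ring.
  by rewrite lt_eqF//; lra.
have eN X : orthogonal_to v X -> e \notin X by move=> o; apply: contra ve => /o ->.
have segS j : (segment_span A h x z j <= segment_span A h x y j)%VS.
  by apply: segment_spanS; apply: active_convex.
exists y, e, i; split=> //.
- apply: (reach_step wx); split; last by move=> j jC; rewrite subsetI Cx// Cy.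
  split; first by rewrite /y addrC addKr; apply: orthogonalZ.
  by apply: deficiency_leV dxz => j _.
- by split=> //; apply: mem_dir_span => //; apply: (subsetP (Cy i iC)).
- exact: eN.
move=> M MJ; rewrite dimv_add_line ?eN// addn0.
pose X := join_span L0 (segment_span A h x z) M.
have eX : e \notin X.
  apply: eN; apply: orthogonal_add => //; apply: orthogonal_sum => j _.
  exact: orthogonal_segment_span.
have : (X + <[e]> <= join_span (L0 + <[e]>)%VS (local_span A h y) M)%VS.
  rewrite subv_add; apply/andP; split; last exact: subv_trans (addvSr _ _) (join_span_ge _ _ _).
  apply: join_spanS; first exact: addvSl.
  by move=> j _; apply: subv_trans (segS j) (segment_local_span _ _ _ _ _).
move=> /dimvS; rewrite (dimv_add_line eX); apply: leq_trans.
by rewrite addSn ltnS; have := dxz M MJ; rewrite addn0.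
Qed.

Lemma perturb A h x v :
  exists y, [/\ exists2 e, 0 < e & y = x + e *: v,
    forall i, active (active (A i) (h i) x) (fun=> 0) v \subset active (A i) (h i) y &
    forall i, active (A i) (h i) y \subset active (A i) (h i) x].
Proof.
have [e eP] := choice (fun i => @active_perturb R n T ex (A i) (h i) x v).
pose m := \big[Num.min/1]_i e i.
have m0 : 0 < m by rewrite /m; elim/big_rec: _ => // i y _ y0; rewrite lt_min y0 (eP i).1.
have mP i : m <= e i by rewrite /m (bigD1 i)//= ge_min lexx.
exists (x + m *: v); split; first by exists m.
  by move=> i; have [] := (eP i).2 m m0 (mP i).
by move=> i; have [] := (eP i).2 m m0 (mP i).
Qed.

(** In [descend] and [tight_perturbation] this is applied to the homogeneous
    polynomials formed by the active terms, to find a direction in which the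
    family stays stable. *)
Definition stable_points_exist m : Prop := forall A h L J p, #|J| = m ->
  deficiency_le 0 L (global_span A) J ->
  exists v, orthogonal_to (v - p) L /\ deficiency_le 0 L (local_span A h v) J.

(** As long as [u] is not in the span of the active directions, one can slide
    down along a direction orthogonal to all of them.  Where one gets stuck,
    the value of [u] is determined by the active terms, so there are finitely
    many such values; and one can still descend strictly, because the stable
    intersection of the active parts, taken as homogeneous polynomials, meets
    the hyperplane on which [u] takes the value [-1]. *)
Lemma descend A h L J u w : stable_points_exist #|J| -> u \notin L ->
  deficiency_le 0 (L + <[u]>)%VS (local_span A h w) J ->
  forall c, exists z, reach (rigid_step A h L J) w z /\ dot z u < c.
Proof.
move=> exJ uL hw c.
pose step x y := orthogonal_to (y - x) L /\ deficiency_le 0 (L + <[u]>)%VS (segment_span A h x y) J.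
suff [z [wz zc]] : exists z, reach step w z /\ dot z u < c.
  exists z; split=> //; apply: reach_sub wz => x y [o d]; split=> //.
  exact: deficiency_le_base (addvSl _ _) d.
apply: contrapT => no.
have bound z : reach step w z -> c <= dot z u.
  by move=> wz; rewrite leNgt; apply/negP => lt; apply: no; exists z.
have locP z : reach step w z -> deficiency_le 0 (L + <[u]>)%VS (local_span A h z) J.
  case=> // x y _ [_]; apply: deficiency_leV => i _; exact: segment_local_span.
have orthP z : reach step w z -> orthogonal_to (z - w) L.
  elim=> [|x y _ IH [o _]]; first by rewrite subrr; apply: orthogonal0.
  have -> : y - w = (y - x) + (x - w) by rewrite addrA subrK.
  exact: orthogonalD.
(* every direction orthogonal to [L] along which all ties persist fixes [u] *)
pose stuck x := u \in join_span L (local_span A h x) J.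
have slide x : reach step w x -> exists y, [/\ reach step w y, dot y u <= dot x u & stuck y].
  have [N] := ubnP (\sum_(i in J) #|A i :\: active (A i) (h i) x|)%N.
  elim: N x => // N IH x ltN wx.
  have [ux|ux] := boolP (u \in join_span L (local_span A h x) J); first by exists x.
  have [v' [ov' v'u]] := exists_orthogonal ux; pose v := - v'.
  have ov : orthogonal_to v (join_span L (local_span A h x) J) by apply: orthogonalN.
  have vu : dot v u = -1 by rewrite dotNl v'u.
  have ovL : orthogonal_to v L by apply: orthogonalS ov; apply: join_span_ge.
  have ovi i : i \in J -> orthogonal_to v (dir_span (active (A i) (h i) x)).
    by move=> iJ; apply: orthogonalS ov; apply: (join_span_sup _ _ iJ).
  have xb i : i \in J -> exists b, b \in active (A i) (h i) x.
    by move=> iJ; exact: (term_exists_of_deficiency (locP _ wx) iJ erefl).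
  have moved s : 0 <= s -> (forall i b d, i \in J -> b \in active (A i) (h i) x -> d \in A i ->
       term_value (h i) (x + s *: v) b <= term_value (h i) (x + s *: v) d) ->
     (forall i, i \in J -> active (A i) (h i) x \subset active (A i) (h i) (x + s *: v))
     /\ reach step w (x + s *: v).
    move=> s0 le.
    have sub i : i \in J -> active (A i) (h i) x \subset active (A i) (h i) (x + s *: v).
      move=> iJ; have [b bx] := xb i iJ.
      by apply: (active_move bx (subxx _) (ovi i iJ)) => d dA; apply: le.
    split=> //; apply: (reach_step wx); split.
      by rewrite addrC addKr; apply: orthogonalZ.
    apply: deficiency_leV (locP _ wx) => i iJ.
    by apply: dir_spanS; rewrite subsetI subxx sub.
  pose bad (p : I * T * T) := [&& p.1.1 \in J, p.1.2 \in active (A p.1.1) (h p.1.1) x,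
    p.2 \in A p.1.1 & dot v (ex p.2) - dot v (ex p.1.2) < 0].
  have [[p0 bad0]|nobad] := pselect (exists p, bad p); last first.
    (* no term ever becomes active, so one can slide to the value [c - 1] *)
    pose s := dot x u - c + 1.
    have s0 : 0 <= s by have := bound x wx; rewrite /s; lra.
    have [|_ ws] := moved s s0.
      move=> i b d iJ bx dA; rewrite !term_valueD.
      have /activeP[_ /(_ d dA) bd] := bx.
      have : 0 <= dot v (ex d) - dot v (ex b).
        by rewrite leNgt; apply/negP => lt; apply: nobad; exists (i, b, d); rewrite /bad /= iJ bx dA.
      nra.
    by have := bound _ ws; rewrite dotDl dotZl vu /s; lra.
  pose cr (p : I * T * T) := (term_value (h p.1.1) x p.2 - term_value (h p.1.1) x p.1.2) /
     - (dot v (ex p.2) - dot v (ex p.1.2)).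
  have [[[i b] d] badp pmin] := @Order.TotalTheory.arg_minP _ _ _ p0 bad cr bad0.
  have /and4P[/= iJ bx dA lt] := badp.
  pose s := cr (i, b, d).
  have s0 : 0 <= s.
    rewrite /s /cr /=; apply: divr_ge0; last by rewrite oppr_ge0 ltW.
    by rewrite subr_ge0; case/activeP: bx => _ ->.
  have [|sub ws] := moved s s0.
    move=> j b' d' jJ bx' dA'; rewrite !term_valueD.
    have /activeP[_ /(_ d' dA') bd'] := bx'.
    have [ge|lt'] := leP 0 (dot v (ex d') - dot v (ex b')); first by nra.
    have := pmin (j, b', d'); rewrite /bad /= jJ bx' dA' lt' => /(_ isT).
    rewrite -/s /cr /= ler_pdivlMr ?oppr_gt0//; lra.
  have dx : d \notin active (A i) (h i) x.
    apply/negP => dx; move: lt; rewrite (orthogonal_dir_spanE (ovi i iJ) dx bx); lra.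
  have dy : d \in active (A i) (h i) (x + s *: v).
    apply: (active_of_le (subsetP (sub i iJ) _ bx) dA); rewrite !term_valueD.
    have : s * - (dot v (ex d) - dot v (ex b)) =
        term_value (h i) x d - term_value (h i) x b.
      by rewrite /s /cr /= divfK// oppr_eq0 lt_eqF.
    lra.
  have [|y [wy yu sy]] := IH (x + s *: v) _ ws.
    rewrite -ltnS; apply: leq_trans ltN; rewrite ltnS (bigD1 i iJ) /= [leqRHS](bigD1 i iJ) /=.
    rewrite -addSn leq_add//.
      apply: proper_card; apply/properP; split; first by apply: setDS; apply: sub.
      by exists d; rewrite in_setD ?dx ?dA// dy.
    by apply: leq_sum => j /andP[jJ _]; apply: subset_leq_card; apply: setDS; apply: sub.
  exists y; split=> //; apply: le_trans yu _; rewrite dotDl dotZl vu; lra.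
have strict x : reach step w x -> exists y, reach step w y /\ dot y u < dot x u.
  move=> wx; have [q [oq qu]] := exists_orthogonal uL.
  have [v [ov dv]] := exJ (fun i => active (A i) (h i) x) (fun _ _ => 0) (L + <[u]>)%VS J (- q)
    erefl (locP x wx).
  have [y [[e e0 yE] y1 _]] := perturb A h x v.
  have vu : dot v u = -1.
    have := ov u; rewrite memvE addvSr => /(_ isT).
    rewrite opprK dotDl qu; lra.
  exists y; split; last by rewrite yE dotDl dotZl vu; lra.
  apply: (reach_step wx); split.
    rewrite yE addrC addKr; apply: orthogonalZ.
    have -> : v = (v - - q) + (- q) by rewrite subrK.
    by apply: orthogonalD; [apply: orthogonalS ov; apply: addvSl|apply: orthogonalN].
  apply: deficiency_leV dv => i _; apply: dir_spanS.
  by rewrite subsetI y1 andbT active_sub.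
(* among the active sets realized at stuck points, take one of least value *)
pose has_type (t : {ffun I -> {set T}}) y :=
  [/\ reach step w y, stuck y & t = [ffun i => active (A i) (h i) y]].
have /choice[rep repP] t : exists r, (exists y, has_type t y) -> has_type t r.
  have [[y ty]|nt] := pselect (exists y, has_type t y); first by exists y.
  by exists 0 => /nt.
have [y0 [wy0 _ sy0]] := slide w (reach_refl _ _).
pose realized (t : {ffun I -> {set T}}) : bool := `[< exists y, has_type t y >].
have t0 : realized [ffun i => active (A i) (h i) y0] by apply/asboolP; exists y0.
have [t /asboolP tr tmin] := @Order.TotalTheory.arg_minP _ _ _ _ realized (fun t => dot (rep t) u) t0.
have [wt st _] := repP t tr.
have [y1 [wy1 lt1]] := strict _ wt.
have [y2 [wy2 le2 sy2]] := slide _ wy1.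
pose t2 := [ffun i => active (A i) (h i) y2].
have r2 : exists y, has_type t2 y by exists y2.
have := tmin t2 (introT (asboolP _) r2).
have [wr sr] := repP t2 r2.
set r := rep t2 in wr sr * => t2E.
have : dot (r - y2) u = 0.
  have o : orthogonal_to (r - y2) (join_span L (local_span A h y2) J).
    apply: orthogonal_add.
      have -> : r - y2 = (r - w) + - (y2 - w) by rewrite opprB addrA subrK.
      by apply: orthogonalD; [exact: orthP|apply/orthogonalN/orthP].
    apply: orthogonal_sum => i _; have := @orthogonal_common_active R n T ex (A i) (h i) y2 r.
    have -> : active (A i) (h i) r = active (A i) (h i) y2.
      by have /ffunP/(_ i) := t2E; rewrite !ffunE.
    by rewrite setIid.
  exact: o.
rewrite dotBl; lra.
Qed.

End Paths.

(** * Moving to a stable point *)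

Section StablePoints.
Variables (R : realType) (n : nat) (I T : finType) (ex : T -> 'rV[R]_n).
Implicit Types (A : I -> {set T}) (h : I -> T -> R) (x y z v w u : 'rV[R]_n).
Implicit Types (L : {vspace 'rV[R]_n}) (S J C M : {set I}).

Local Notation active := (active ex).
Local Notation dir_span := (dir_span ex).
Local Notation global_span := (global_span ex).
Local Notation local_span := (local_span ex).
Local Notation segment_span := (segment_span ex).
Local Notation monotone_step := (monotone_step ex).
Local Notation rigid_step := (rigid_step ex).

(** The set [S] of [m] hypersurfaces has to be independent globally, that is,
    with respect to all exponents; the point [z] is then stable for [S]. *)
Definition joinable m : Prop := forall A h L S w, #|S| = m ->
  deficiency_le 0 L (global_span A) S ->
  exists z, reach (monotone_step A h L S w) w z /\ deficiency_le 0 L (local_span A h z) S.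

(** For [L = 0], the last hypothesis says that [w] lies in the intersection of
    the hypersurfaces. *)
Definition joinable_on m : Prop := forall A h L S w, #|S| = m ->
  deficiency_le 0 L (global_span A) S ->
  (forall i, i \in S -> ~~ (local_span A h w i <= L)%VS) ->
  exists z, reach (monotone_step A h L S w) w z /\ deficiency_le 0 L (local_span A h z) S.

Lemma joinable_exists m : joinable m -> stable_points_exist I ex m.
Proof.
move=> jm A h L J p cJ hJ; have [z [pz dz]] := jm A h L J p cJ hJ.
exists z; split=> //; elim: pz => [|x y _ IH [o _]]; first by rewrite subrr; apply: orthogonal0.
have -> : y - p = (y - x) + (x - p) by rewrite addrA subrK.
exact: orthogonalD.
Qed.

(** Along a segment where the active terms of [C] persist and the other members
    stay independent modulo the span of [C], ranks do not drop: a subfamily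
    splits into its part in [C], which loses no direction, and a part that is
    independent modulo everything spanned by the former. *)
Lemma stay_monotone A h L S C w x y : C \subset S ->
  rigid_step A h (join_span L (local_span A h w) C) (S :\: C) x y ->
  (forall i, i \in C ->
    active (A i) (h i) w \subset active (A i) (h i) x :&: active (A i) (h i) y) ->
  monotone_step A h L S w x y.
Proof.
set L0 := join_span L _ C => CS [o d] stay; split; first exact: orthogonalS (join_span_ge _ _ _) o.
move=> M MS hM M' M'M.
have M'S := fintype.subset_trans M'M MS.
pose M1 := M' :&: C; pose M2 := M' :\: C.
pose X := join_span L (local_span A h w) M1.
have XL0 : (X <= L0)%VS by apply: join_spanT; apply: subsetIr.
have le1 : (\dim L + #|M1| <= \dim X)%N.
  by have := hM M1 (fintype.subset_trans (subsetIl _ _) M'M); rewrite addn0.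
have le2 := dim_join_span_ge XL0 d (setSD C M'S).
have le3 : (join_span X (segment_span A h x y) M2 <=
    join_span L (segment_span A h x y) M')%VS.
  apply: join_span_le => [|i]; last first.
    by rewrite inE => /andP[_ iM]; apply: join_span_sup.
  apply: join_span_le; first exact: join_span_ge.
  move=> i; rewrite inE => /andP[iM iC]; apply: subv_trans (join_span_sup _ _ iM).
  by apply: dir_spanS; apply: stay.
rewrite addn0; apply: leq_trans (dimvS le3); apply: leq_trans le2.
by rewrite -(cardsID C M') addnA leq_add2r.
Qed.

(** Let [C] be a critical subfamily at [w], spanning [L0]; the
    other members [J] are independent modulo [L0].  As the whole family is
    independent globally, some direction [u] between a term active at [w] and
    another term, of the same member of [C], can be adjoined to [J].  Replacing
    [C] by the hyperplane through [w] normal to [u], one moves by induction to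
    a point where [J] is independent modulo [L0] and [u], and from there one
    decreases [u] without bound.  The active terms of [C] cannot all survive
    this, and where new ones appear the deficiency has dropped. *)
Lemma decrease_deficiency A h L S w d C : deficiency_le 0 L (global_span A) S ->
  C \subset S -> (\dim L + #|C| = \dim (join_span L (local_span A h w) C) + d.+1)%N ->
  deficiency_le 0 (join_span L (local_span A h w) C) (local_span A h w) (S :\: C) ->
  (forall M, M \proper C -> (\dim L + #|M| <= \dim (join_span L (local_span A h w) M) + d)%N) ->
  joinable_on #|S :\: C|.+1 -> joinable #|S :\: C| ->
  exists y, reach (monotone_step A h L S w) w y /\ deficiency_le d L (local_span A h y) S.
Proof.
set L0 := join_span L _ C; set J := S :\: C => gS CS eC hJ hC jon jo.
have Cb i : i \in C -> exists b, b \in active (A i) (h i) w.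
  move=> iC; have [a aA] := term_exists_of_deficiency gS (subsetP CS _ iC) erefl.
  exact: active_nonempty aA.
have gJ : deficiency_le 0 L0 (global_span A) J.
  by apply: deficiency_leV hJ => i _; apply: local_global_span.
have CL i : i \in C -> (local_span A h w i <= L0)%VS by move=> iC; apply: join_span_sup.
pose U := [seq ex p.2.2 - ex p.2.1 | p <- enum [pred p : I * (T * T) |
  [&& p.1 \in C, p.2.1 \in active (A p.1) (h p.1) w & p.2.2 \in A p.1]]].
have CU i : i \in C -> (global_span A i <= <<U>>)%VS.
  move=> iC; have [b bw] := Cb i iC.
  have bU c : c \in A i -> ex c - ex b \in <<U>>%VS.
    move=> cA; apply: memv_span; apply/mapP; exists (i, (b, c)) => //.
    by rewrite mem_enum inE /= iC bw.
  apply/dir_spanP => a a' aA aA'.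
  have -> : ex a - ex a' = (ex a - ex b) - (ex a' - ex b) by rewrite opprB addrA subrK.
  by apply: rpredB; apply: bU.
have [|u [uU uL0 gu]] := adjoin_vector (U := U) gJ.
  move=> M MJ.
  have le : (join_span L (global_span A) (C :|: M) <= join_span (L0 + <<U>>) (global_span A) M)%VS.
    apply: join_span_le.
      exact: subv_trans (subv_trans (join_span_ge _ _ _) (addvSl _ _)) (join_span_ge _ _ _).
    move=> i; rewrite inE => /orP[iC|iM]; last exact: join_span_sup.
    exact: subv_trans (subv_trans (CU i iC) (addvSr _ _)) (join_span_ge _ _ _).
  have MS : M \subset S := fintype.subset_trans MJ (subsetDl _ _).
  have := gS (C :|: M); rewrite subUset CS MS => /(_ isT).
  have := dimvS le; have := cardsUI C M.
  have -> : C :&: M = set0.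
    apply/setP => i; rewrite in_set0 in_setI; apply/negbTE/negP => /andP[iC /(subsetP MJ)].
    by rewrite in_setD iC.
  rewrite cards0 !addn0 => cU dle gC; apply: leq_trans dle; apply: leq_trans gC.
  by rewrite cU addnA eC -addnA (addnC d.+1) addnA addnS ltnS leq_addr.
case/mapP: uU => -[i [b a]]; rewrite mem_enum inE /= => /and3P[iC bw aA] uE.
have iJ : i \notin J by rewrite in_setD iC.
(* the coefficients make both terms of the new member [i] active at [w] *)
pose A' j := if j == i then [set a; b] else A j.
pose h' j := if j == i then (fun c => - dot w (ex c)) else h j.
have A'J j : j \in J -> A' j = A j /\ h' j = h j.
  move=> jJ; have /negbTE ji : j != i by apply: contraNneq iJ => <-.
  by rewrite /A' /h' ji.
have locJ x j : j \in J -> local_span A' h' x j = local_span A h x j.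
  by move=> /A'J[e1 e2]; rewrite -[LHS]/(dir_span (active (A' j) (h' j) x)) e1 e2.
have segJ x y j : j \in J -> segment_span A' h' x y j = segment_span A h x y j.
  by move=> /A'J[e1 e2]; rewrite -[LHS]/(dir_span (active (A' j) (h' j) x :&: active (A' j) (h' j) y)) e1 e2.
have gloJ j : j \in J -> global_span A' j = global_span A j.
  by move=> /A'J[e1 _]; rewrite -[LHS]/(dir_span (A' j)) e1.
have uloc : u \in local_span A' h' w i.
  rewrite uE -[local_span _ _ _ _]/(dir_span (active (A' i) (h' i) w)) /A' /h' eqxx.
  apply: mem_dir_span; apply/activeP; rewrite !inE eqxx ?orbT; split=> // c _.
    by rewrite /term_value !addNr.
  by rewrite /term_value !addNr.
have locu x : (local_span A' h' x i <= <[u]>)%VS.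
  apply: subv_trans (local_global_span _ _ _ _ _) _.
  rewrite -[global_span _ _]/(dir_span (A' i)) /A' eqxx; apply/dir_spanP => c c'; rewrite !inE.
  move=> /orP[/eqP->|/eqP->] /orP[/eqP->|/eqP->]; rewrite ?subrr ?mem0v//.
    by rewrite -uE memv_line.
  by rewrite -opprB -uE rpredN memv_line.
have gS' : deficiency_le 0 L0 (global_span A') (i |: J).
  move=> M MS'.
  have MiJ : M :\ i \subset J.
    by rewrite subDset (fintype.subset_trans MS') //.
  have [iM|iM] := boolP (i \in M); last first.
    have MJ : M \subset J.
      apply/subsetP => j jM; have := subsetP MS' _ jM; rewrite in_setU1.
      by move=> /orP[/eqP ji|//]; rewrite -ji jM in iM.
    apply: leq_trans (gJ M MJ) _; rewrite !addn0; apply/dimvS/join_spanS => // j jM.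
    by rewrite gloJ// (subsetP MJ).
  have := deficiency_le_add1 uL0 gu MiJ.
  have -> : #|M| = #|M :\ i|.+1 by rewrite (cardsD1 i M) iM.
  rewrite addSn -addnS addn0 => h1; apply: leq_trans h1 _; apply/dimvS/join_span_le.
    rewrite subv_add join_span_ge /=; apply: subv_trans (join_span_sup _ _ iM).
    by rewrite -memvE; apply: subvP uloc; apply: local_global_span.
  move=> j jM; rewrite -gloJ ?(subsetP MiJ)//; apply: join_span_sup.
  by move: jM; rewrite in_setD => /andP[].
have cS' : #|i |: J| = #|J|.+1 by rewrite cardsU1 iJ.
have single j : j \in i |: J -> ~~ (local_span A' h' w j <= L0)%VS.
  rewrite in_setU1 => /orP[/eqP->|jJ].
    by apply: contra uL0 => /subvP; apply.
  by rewrite locJ//; apply/deficiency_le_set1; apply: deficiency_leS hJ; rewrite sub1set.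
have [w1 [ww1 dw1]] := jon A' h' L0 (i |: J) w cS' gS' single.
have rw1 : reach (rigid_step A h L0 J) w w1.
  apply: reach_sub ww1 => x y [o mono]; split=> //.
  apply: (deficiency_leV (V := segment_span A' h' x y)); first by move=> j jJ; rewrite segJ.
  apply: mono; first exact: subsetUr.
  by apply: deficiency_leV hJ => j jJ; rewrite locJ.
have dw1u : deficiency_le 0 (L0 + <[u]>)%VS (local_span A h w1) J.
  move=> M MJ; rewrite dimv_add_line// addn0.
  have iM : i \notin M by apply: contra iJ; apply: subsetP.
  have := dw1 (i |: M) (setUS _ MJ); rewrite cardsU1 iM addn0 addnA addn1 => h1.
  apply: leq_trans h1 _; apply/dimvS/join_span_le.
    exact: subv_trans (addvSl _ _) (join_span_ge _ _ _).
  move=> j; rewrite in_setU1 => /orP[/eqP->|jM].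
    exact: subv_trans (subv_trans (locu _) (addvSr _ _)) (join_span_ge _ _ _).
  by rewrite locJ ?(subsetP MJ)//; apply: join_span_sup.
have [w2 [w12 w2u]] := descend (joinable_exists jo) uL0 dw1u (h i b - h i a).
have [[_ /(_ i iC)/subsetP/(_ b bw)/activeP[_ /(_ a aA)]]|] :=
  leave_or_stay CL Cb (reach_trans rw1 w12).
  by move: w2u; rewrite uE /term_value dotBr; lra.
move=> [y [e [k [wy Cy [kC eloc] eL0 dy]]]].
exists y; split.
  by apply: reach_sub wy => x z [rs st]; apply: (stay_monotone CS).
move=> M MS; pose M1 := M :&: C; pose M2 := M :\: C.
have M2J : M2 \subset J by apply: setSD.
have cM : #|M| = (#|M1| + #|M2|)%N by rewrite cardsID.
pose X := join_span L (local_span A h w) M1.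
have leX : (X <= join_span L (local_span A h y) M)%VS.
  apply: join_span_le; first exact: join_span_ge.
  move=> j; rewrite in_setI => /andP[jM jC]; apply: subv_trans (join_span_sup _ _ jM).
  by apply: dir_spanS; apply: Cy.
have leM2 j : j \in M2 -> (local_span A h y j <= join_span L (local_span A h y) M)%VS.
  by rewrite in_setD => /andP[_]; apply: join_span_sup.
have [M1C|M1C] := boolP (M1 \proper C).
  have XL0 : (X <= L0 + <[e]>)%VS.
    by apply: subv_trans (addvSl _ _); apply: join_spanT; apply: subsetIr.
  have h1 := dim_join_span_ge XL0 dy M2J; have h2 := hC M1 M1C; rewrite -/X in h2.
  have h3 := dimvS (join_span_le leX leM2).
  rewrite cM addnA; apply: (leq_trans (leq_add h2 (leqnn _))); rewrite addnAC leq_add2r.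
  exact: leq_trans h1 h3.
have M1E : M1 = C.
  apply/eqP; rewrite eqEsubset subsetIr /=; apply: contraNT M1C => nC.
  by rewrite properE subsetIr.
have leL0e : (L0 + <[e]> <= join_span L (local_span A h y) M)%VS.
  rewrite subv_add; apply/andP; split; first by move: leX; rewrite /X M1E.
  rewrite -memvE; apply: subvP eloc; apply: join_span_sup.
  by move: kC; rewrite -M1E in_setI => /andP[].
have h3 := dimvS (join_span_le leL0e leM2); have := dim_join_span_ge (subvv _) dy M2J.
rewrite (dimv_add_line eL0) => h1.
rewrite cM M1E addnA eC addnS -addSn addnAC leq_add2r; exact: leq_trans h1 h3.
Qed.

(** Iterating [decrease_deficiency], for points with a property [good] that is
    stable under monotone paths and provides the induction hypotheses. *)
Lemma join_good A h L S (good : 'rV[R]_n -> Prop) w :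
  deficiency_le 0 L (global_span A) S ->
  (forall x y, good x -> reach (monotone_step A h L S x) x y -> good y) ->
  (forall x d C, good x -> C \subset S ->
    (\dim L + #|C| = \dim (join_span L (local_span A h x) C) + d.+1)%N ->
    joinable_on #|S :\: C|.+1 /\ joinable #|S :\: C|) ->
  good w ->
  exists z, reach (monotone_step A h L S w) w z /\ deficiency_le 0 L (local_span A h z) S.
Proof.
move=> gS good_reach IHs.
have : deficiency_le #|S| L (local_span A h w) S.
  move=> M MS; have := subset_leq_card MS.
  have := dimvS (join_span_ge L (local_span A h w) M); lia.
elim: #|S| w => [|d IH] w dw gw; first by exists w; split=> //; exact: reach_refl.
have [dw'|dw'] := pselect (deficiency_le d L (local_span A h w) S); first exact: IH.
have [C [CS eC hJ hC]] := critical_subfamily dw dw'.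
have [jon jo] := IHs w d C gw CS eC.
have [y [wy dy]] := decrease_deficiency gS CS eC hJ hC jon jo.
have [z [yz dz]] := IH y dy (good_reach _ _ gw wy).
exists z; split=> //; apply: (reach_trans wy); apply: reach_sub yz => x x' [o mono].
by split=> // M MS hM; apply: mono => //; apply: reach_monotone_local wy _ MS hM.
Qed.

(** The induction alternates between the two statements: a critical subfamily
    [C] leads to the families of sizes [m - #|C| + 1] and [m - #|C|].  On the
    intersection of the hypersurfaces [C] has at least two members, so both
    sizes are smaller than [m]; elsewhere the first size can be [m] itself, but
    then only the statement for points of the intersection is used. *)
Lemma joinable_all m : joinable_on m /\ joinable m.
Proof.
have [k] := ubnP m; elim: k m => // k IH m ltm.
have C_gt0 C S L A h w d : C \subset S ->
    (\dim L + #|C| = \dim (join_span L (local_span A h w) C) + d.+1)%N -> (0 < #|C|)%N.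
  move=> CS; rewrite lt0n; apply: contraPneq => /eqP; rewrite cards_eq0 => /eqP->.
  by rewrite join_span0 cards0; lia.
have jon : joinable_on m.
  move=> A h L S w cS gS sw.
  apply: (join_good (good := fun x => forall i, i \in S -> ~~ (local_span A h x i <= L)%VS)) => //.
    move=> x y gx xy i iS; apply/deficiency_le_set1; apply: (reach_monotone_local xy).
      by rewrite sub1set.
    by apply/deficiency_le_set1; apply: gx.
  move=> x d C gx CS eC; have C0 := C_gt0 _ _ _ _ _ _ _ CS eC.
  have C1 : #|C| != 1%N.
    apply/eqP => /eqP/cards1P[i Ci]; move: eC; rewrite Ci cards1.
    have iS : i \in S by apply: (subsetP CS); rewrite Ci inE.
    have /deficiency_le_set1 /(_ [set i] (subxx _)) := gx i iS.
    rewrite cards1; lia.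
  have := cardsDS CS; have := subset_leq_card CS => l1 l2.
  by split; [apply: (IH _ _).1|apply: (IH _ _).2]; lia.
split=> // A h L S w cS gS; apply: (join_good (good := fun=> True)) => // x d C _ CS eC.
have C0 := C_gt0 _ _ _ _ _ _ _ CS eC.
have := cardsDS CS; have := subset_leq_card CS => l1 l2.
split; last by apply: (IH _ _).2; lia.
have [->//|ne] := eqVneq #|S :\: C|.+1 m.
by apply: (IH _ _).1; lia.
Qed.

End StablePoints.

(** * Transversal cells through a stable point *)

Section Flags.
Variables (R : realType) (n : nat) (I T : finType) (ex : T -> 'rV[R]_n).
Variables (A : I -> {set T}) (h : I -> T -> R).
Implicit Types (x y z v w u : 'rV[R]_n) (L : {vspace 'rV[R]_n}).
Implicit Types (S J M : {set I}) (F : I -> {set T}) (s : seq I).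

Local Notation active_at i x := (active ex (A i) (h i) x).
Local Notation dir_span := (dir_span ex).
Local Notation local_span x := (local_span ex A h x).
Local Notation sum_span V J := (\sum_(j in J) V j)%VS.

(** Near a stable point there are stable points at which the active directions
    of the family span only as many dimensions as there are hypersurfaces, and
    meet [L] trivially: as long as this fails for some [u], a move along
    which [u] is not constant makes some term inactive. *)
Lemma tight_perturbation L J y : deficiency_le 0 L (local_span y) J ->
  exists z, [/\ forall i, active_at i z \subset active_at i y,
    deficiency_le 0 L (local_span z) J,
    \dim (sum_span (local_span z) J) = #|J| &
    (L :&: sum_span (local_span z) J = 0)%VS].
Proof.
have [N] := ubnP (\sum_(i in J) #|active_at i y|)%N.
elim: N y => // N IH y ltN hy.
pose E := sum_span (local_span y) J.
have shrink L' u : (L <= L')%VS -> deficiency_le 0 L' (local_span y) J ->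
    u \in E -> u \in L' -> u != 0 -> exists z, [/\ forall i, active_at i z \subset active_at i y,
    deficiency_le 0 L (local_span z) J,
    \dim (sum_span (local_span z) J) = #|J| & (L :&: sum_span (local_span z) J = 0)%VS].
  move=> LL' hy' uE uL' u0.
  have [p [_ pu]] : exists p, orthogonal_to p 0%VS /\ dot p u = 1.
    by apply: exists_orthogonal; rewrite memv0.
  have [v [ov dv]] := joinable_exists (joinable_all I ex #|J|).2 (fun _ _ => 0) p erefl hy'.
  have vu : dot v u = 1 by have := ov u uL'; rewrite dotBl pu; lra.
  have [z [[e e0 zE] vz zy]] := perturb ex A h y v.
  have [||z2 [z2z d2 t2 c2]] := IH z _ _.
    - rewrite -ltnS; apply: leq_trans ltN; rewrite ltnS.
      have [i [iJ ne]] : exists i, i \in J /\ active_at i z != active_at i y.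
        apply: contrapT => no; suff : dot v u = 0 by rewrite vu => /eqP; rewrite oner_eq0.
        have ovE : orthogonal_to v E.
          apply: orthogonal_sum => i iJ; have e1 : active_at i z = active_at i y.
            by apply: contrapT => /eqP ne; apply: no; exists i.
          have := @orthogonal_common_active R n T ex (A i) (h i) y z.
          rewrite e1 setIid zE addrC addKr => oe.
          by rewrite -[v](scalerK (lt0r_neq0 e0)); apply: orthogonalZ.
        exact: ovE.
      rewrite (bigD1 i iJ) /= [leqRHS](bigD1 i iJ) /= -addSn leq_add//.
        by apply: proper_card; rewrite properEneq ne zy.
      by apply: leq_sum => j _; apply/subset_leq_card/zy.
    - apply: deficiency_le_base LL' _; apply: deficiency_leV dv => i _.
      by apply: dir_spanS; apply: vz.
  by exists z2; split=> // i; apply: fintype.subset_trans (z2z i) (zy i).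
have [c0|c0] := eqVneq (L :&: E)%VS 0%VS; last first.
  have uc := memv_pick (L :&: E); apply: (shrink L (vpick (L :&: E))) => //.
  - by move: uc; rewrite memv_cap => /andP[].
  - by move: uc; rewrite memv_cap => /andP[].
  - by rewrite vpick0.
have dE : \dim (join_span L (local_span y) J) = (\dim L + \dim E)%N.
  by rewrite /join_span dimv_disjoint_sum.
have := hy J (subxx _); rewrite dE addn0 leq_add2l leq_eqVlt => /orP[/eqP tE|ltE].
  by exists y; split=> // i; apply: subxx.
have [|u [uE uL hu]] := adjoin_vector (U := vbasis E) hy.
  move=> M MJ; rewrite (span_basis (vbasisP E)).
  have : (join_span L (local_span y) J <= join_span (L + E) (local_span y) M)%VS by apply: join_span_ge.
  move=> /dimvS; rewrite dE; apply: leq_trans.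
  by rewrite ltn_add2l (leq_ltn_trans (subset_leq_card MJ)).
apply: (shrink (L + <[u]>)%VS u) => //; first exact: addvSl.
- exact: vbasis_mem uE.
- by rewrite memvE addvSr.
- by apply: contra uL => /eqP->; apply: mem0v.
Qed.

(** Faces [F j] of the members of [s] with independent spans, such that the
    cells dual to the members of each initial part intersect in a polyhedron of
    the expected dimension: near the point [y], this polyhedron contains the
    orthogonal complement of the sum of their spans.  The last member is the
    head of [s]. *)
Fixpoint flag F s : Prop := if s is i :: s' then
  [/\ flag F s', exists z, F i = active_at i z, dir_span (F i) != 0%VS,
    (sum_span (fun j => dir_span (F j)) [set j in s'] :&: dir_span (F i) = 0)%VS &
    exists2 y, forall j, j \in s -> F j \subset active_at j y &
      (sum_span (local_span y) [set j in s] <=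
       sum_span (fun j => dir_span (F j)) [set j in s])%VS]
  else True.

Lemma sum_span_cons (V : I -> {vspace 'rV[R]_n}) i s : i \notin s ->
  sum_span V [set j in i :: s] = (sum_span V [set j in s] + V i)%VS.
Proof.
move=> iS; rewrite (bigD1 i) /=; last by rewrite !inE eqxx.
rewrite addvC; congr (_ + _)%VS; apply: eq_bigl => j; rewrite !inE.
by have [->|] := eqVneq j i; rewrite ?(negbTE iS)// andbT.
Qed.

Lemma eq_sum_span (V V' : I -> {vspace 'rV[R]_n}) s : {in s, V =1 V'} ->
  sum_span V [set j in s] = sum_span V' [set j in s].
Proof. by move=> e; apply: eq_bigr => j; rewrite inE => /e. Qed.

Lemma eq_flag F F' s : {in s, F =1 F'} -> flag F s -> flag F' s.
Proof.
elim: s => // i s IH e [fs [z zE] d0 dis [y yF ye]].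
have ei := e i (mem_head _ _).
have es : {in s, F =1 F'} by move=> j js; apply: e; rewrite inE js orbT.
split; [exact: IH|by exists z; rewrite -ei|by rewrite -ei| |].
  by rewrite -ei -(eq_sum_span (V := fun j => dir_span (F j)) (V' := fun j => dir_span (F' j)))// => j js; rewrite es.
exists y; first by move=> j js; rewrite -e// yF.
by rewrite -(eq_sum_span (V := fun j => dir_span (F j)) (V' := fun j => dir_span (F' j)))// => j js; rewrite e.
Qed.

(** At a nearby tight point [z] the directions of the last member supply a
    vector [u] that is independent of the others.  By induction, the others
    have faces whose span [E] does not contain [u].  A perturbation that is
    tight modulo [E], for the last member alone, then selects an edge transversal
    to [E], and [z] lies in all the cells. *)
Lemma flag_exists s L y : uniq s -> deficiency_le 0 L (local_span y) [set j in s] ->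
  exists F, [/\ flag F s, forall j, j \in s -> F j \subset active_at j y,
    (L :&: sum_span (fun j => dir_span (F j)) [set j in s] = 0)%VS &
    \dim (sum_span (fun j => dir_span (F j)) [set j in s]) = size s].
Proof.
elim: s L y => [|i s IH] L y.
  move=> _ _; exists (fun=> set0); rewrite big1 ?capv0 ?dimv0//.
  by move=> j; rewrite inE.
move=> /andP[iS us] hy.
have [z [zy hz tz cz]] := tight_perturbation hy.
have ss : [set j in s] \subset [set j in i :: s].
  by apply/subsetP => j; rewrite !inE => ->; rewrite orbT.
have iii : i \in [set j in i :: s] by rewrite !inE eqxx.
have cS (t : seq I) : uniq t -> #|[set j in t]| = size t.
  by move=> ut; rewrite cardsE; apply/card_uniqP.
have [|u [uz uL hu]] := adjoin_vector (U := vbasis (local_span z i)) (deficiency_leS ss hz).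
  move=> M MJ; rewrite (span_basis (vbasisP _)).
  have iM : i \notin M by apply/negP => /(subsetP MJ); rewrite inE (negbTE iS).
  have := hz (i |: M); rewrite subUset sub1set iii (fintype.subset_trans MJ ss) => /(_ isT).
  rewrite cardsU1 iM addn0 add1n addnS => lt1; apply: leq_trans lt1 _; apply/dimvS.
  apply: join_span_le; first exact: subv_trans (addvSl _ _) (join_span_ge _ _ _).
  move=> j; rewrite in_setU1 => /orP[/eqP->|jM]; last exact: join_span_sup.
  exact: subv_trans (addvSr _ _) (join_span_ge _ _ _).
have u0 : u != 0 by apply: contra uL => /eqP->; apply: mem0v.
have [F0 [f0 F0z c0 d0]] := IH (L + <[u]>)%VS z us hu.
pose E := sum_span (fun j => dir_span (F0 j)) [set j in s]; rewrite -/E in c0 d0.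
have uE : u \notin E.
  apply/negP => uE; have : u \in ((L + <[u]>) :&: E)%VS.
    by rewrite memv_cap uE andbT memvE addvSr.
  by rewrite c0 memv0 (negbTE u0).
have hE : deficiency_le 0 E (local_span z) [set i].
  by apply/deficiency_le_set1; apply: contra uE => /subvP; apply; apply: vbasis_mem uz.
have [z2 [z2z h2 t2 c2]] := tight_perturbation hE.
rewrite big_set1 cards1 in t2; rewrite big_set1 in c2.
pose F j := if j == i then active_at i z2 else F0 j.
have Fi : F i = active_at i z2 by rewrite /F eqxx.
have Fs : {in s, F0 =1 F}.
  by move=> j js; rewrite /F ifN //; apply: contraNneq iS => <-.
have EF : sum_span (fun j => dir_span (F j)) [set j in s] = E.
  by symmetry; apply: eq_sum_span => j js; rewrite Fs.
have sumF : sum_span (fun j => dir_span (F j)) [set j in i :: s] = (E + local_span z2 i)%VS.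
  by rewrite sum_span_cons// EF Fi.
have dimF : \dim (sum_span (fun j => dir_span (F j)) [set j in i :: s]) = (size s).+1.
  by rewrite sumF dimv_disjoint_sum// d0 t2 addn1.
have Fz j : j \in i :: s -> F j \subset active_at j z.
  by rewrite inE => /orP[/eqP->|js]; [rewrite Fi; apply: z2z|rewrite -Fs//; apply: F0z].
have leF : (sum_span (fun j => dir_span (F j)) [set j in i :: s] <=
    sum_span (local_span z) [set j in i :: s])%VS.
  apply/subv_sumP => j jS; apply: (sumv_sup _ jS); apply: dir_spanS; apply: Fz.
  by rewrite inE in jS.
exists F; split=> //.
- split; [exact: eq_flag f0|by exists z2| | |].
  + by rewrite -dimv_eq0 Fi -[X in \dim X]/(local_span z2 i) t2.
  + by rewrite EF Fi.
  exists z => //; suff /eqP-> : sum_span (fun j => dir_span (F j)) [set j in i :: s] ==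
      sum_span (local_span z) [set j in i :: s] by [].
  have ui : uniq (i :: s) by rewrite /= iS.
  by rewrite eqEdim leF dimF tz (cS _ ui) leqnn.
- by move=> j js; apply: fintype.subset_trans (Fz j js) (zy j).
- by apply/eqP; rewrite -subv0 -[X in (_ <= X)%VS]cz; exact: capvS (subvv _) leF.
Qed.

End Flags.

From mathcomp Require Import classical_sets.
Local Open Scope classical_set_scope.
Local Open Scope ring_scope.

(** * Cells of tropical hypersurfaces *)

Section Cells.
Variables (R : realType) (K : fieldType) (nu : K -> R) (n : nat).
Variable D : {fset 'rV[int]_n}.
Implicit Types (f : laurent K n) (w x y z : 'rV[R]_n).

Definition exponent (a : D) : 'rV[R]_n := of_int R (val a).
Definition support_terms f : {set D} := [set a : D | val a \in finsupp f]%SET.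
Definition coef_val f (a : D) : R := nu (f (val a)).

Definition active_terms f x : {set D} := active exponent (support_terms f) (coef_val f) x.

Variable f : laurent K n.
Hypothesis fD : (finsupp f `<=` D)%fset.

Let ht w (q : 'rV[R]_n * R^o) : R := dot w q.1 + q.2.
Let pt (a : 'rV[int]_n) : 'rV[R]_n * R^o := (of_int R a, nu (f a)).

Lemma ht_pt w (a : D) : ht w (pt (val a)) = term_value exponent (coef_val f) w a.
Proof. exact: addrC. Qed.

Lemma active_termsP w (a : D) : reflect (val a \in finsupp f /\
   forall b, b \in finsupp f -> ht w (pt (val a)) <= ht w (pt b)) (a \in active_terms f w).
Proof.
apply: (iffP (activeP _ _ _ _ _)); rewrite inE => -[af amin]; split=> //.
  move=> b bf; have bD : b \in D by move/fsubsetP: fD; apply.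
  by have := amin [` bD]%fset; rewrite inE /= => /(_ bf); rewrite -!ht_pt.
by move=> c; rewrite inE => cf; rewrite -!ht_pt; apply: amin.
Qed.

Lemma polytope_pt a : a \in finsupp f -> lifted_polytope nu f (pt a).
Proof. by move=> af E [_ Ef]; apply: Ef; exists a. Qed.

Lemma active_lower w (a : D) : a \in active_terms f w -> lower_face nu f w (pt (val a)).
Proof. by move=> /active_termsP[af amin]; apply: lower_pt. Qed.

Lemma active_subdivision w (a : D) : a \in active_terms f w ->
  subdivision_cell nu f w (exponent a).
Proof. by move=> /active_lower la; exists (pt (val a)). Qed.

Lemma subdivision_active w p : subdivision_cell nu f w p -> exists a, a \in active_terms f w.
Proof.
move=> [q [qL _] _]; have [f0|[a af]] := fset_0Vmem (finsupp f).
  have : lifted_polytope nu f `<=` set0 by apply: hull_convex => // a; rewrite f0 inE.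
  by move=> /(_ q qL).
have aD : a \in D by move/fsubsetP: fD; apply.
by apply: (@active_nonempty _ _ _ _ _ _ _ [` aD]%fset); rewrite inE.
Qed.

(** A lower face of the lifted polytope is determined by the active terms, since
    its points are convex combinations of lifted active exponents only.
    Conversely, the height of the lifted polytope over an exponent active at
    [z] is the coefficient of that term. *)
Lemma dual_cell_subdivision z :
  dual_cell nu f (subdivision_cell nu f z) =
  [set x | active_terms f z \subset active_terms f x].
Proof.
apply/seteqP; split=> x.
  move=> zx; apply/fintype.subsetP => a az; apply/active_termsP.
  have [af _] := active_termsP _ _ az; split=> // b bf.
  have [p [pL pmin] pa] := zx _ (active_subdivision az).
  have [_ /(_ p pL) le1] := active_lower az.
  have le2 := pmin _ (polytope_pt bf).
  move: pa le1 le2; rewrite /ht /pt /= => -> le1 le2.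
  have {}le1 : (nu (f (val a)) : R) <= p.2 by move: le1; rewrite lerD2l.
  by apply: le_trans le2; rewrite /exponent lerD2l.
move=> /fintype.subsetP sub q [p [pL pmin] pq].
have [a az] : exists a, a \in active_terms f z.
  by apply: (@subdivision_active z q); exists p.
exists p => //; split=> // r rL.
have [_ xmin] := active_lower (sub a az).
have : lifted_polytope nu f `<=` [set q | ht z (pt (val a)) < ht z q \/
    (ht z q = ht z (pt (val a)) /\ ht x q = ht x (pt (val a)))].
  apply: hull_convex => [q1 q2 l l0 l1 /= h1 h2|b bf /=].
    have e1 := htA z q1 q2 l; have e2 := htA x q1 q2 l.
    rewrite -!/(ht _ _) in e1 e2.
    case: h1 => [h1|[h1 h1']]; case: h2 => [h2|[h2 h2']];
      [left|left|left|right]; rewrite e1 ?e2 ?h1 ?h1' ?h2 ?h2'; last by split; ring.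
    - nra.
    - nra.
    - nra.
  have bD : b \in D by move/fsubsetP: fD; apply.
  have [bz|bz] := boolP ([` bD]%fset \in active_terms f z).
    right; have bx := sub _ bz.
    have := active_eq az bz; have := active_eq (sub _ az) bx.
    by rewrite -!ht_pt /= => -> ->.
  left; have := active_lt az _ bz; rewrite inE /= => /(_ bf).
  by rewrite -!ht_pt.
move=> /(_ p pL)[lt|[_ ex]].
  by have := pmin _ (polytope_pt (active_termsP _ _ az).1); rewrite leNgt => /negP; case.
have := xmin _ rL; rewrite -!/(ht _ _) in ex * => le; by rewrite ex.
Qed.

Lemma exponent_inj : injective exponent.
Proof. by move=> a b /of_int_inj/val_inj. Qed.

Lemma dir_span_eq0P (B : {set D}) :
  reflect (forall a b, a \in B -> b \in B -> a = b) (dir_span exponent B == 0%VS).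
Proof.
rewrite -subv0; apply: (iffP (dir_spanP _ _ _)) => h a b aB bB; last first.
  by rewrite (h a b aB bB) subrr mem0v.
by apply: exponent_inj; apply/eqP; rewrite -subr_eq0 -memv0; apply: h.
Qed.

Lemma dir_span_neq0 (B : {set D}) : dir_span exponent B != 0%VS ->
  exists a b, [/\ a \in B, b \in B & a != b].
Proof.
move=> d0; apply: contrapT => no; move: d0 => /negP; apply; apply/dir_span_eq0P => a b aB bB.
by apply: contrapT => /eqP ab; apply: no; exists a, b.
Qed.

Lemma subdivision_dimension z :
  (0 < dimension (subdivision_cell nu f z))%N = (dir_span exponent (active_terms f z) != 0%VS).
Proof.
apply/idP/idP => [/dimension_gt0P[x [y [zx zy xy]]]|/dir_span_neq0[a [b [az bz ab]]]].
  have [a az] := subdivision_active zx.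
  apply/negP => /dir_span_eq0P one.
  have [af amin] := active_termsP _ _ az.
  have sub : lower_face nu f z `<=` [set pt (val a)].
    apply: lower_unique => // b bf ba.
    have bD : b \in D by move/fsubsetP: fD; apply.
    have nb : [` bD]%fset \notin active_terms f z.
      by apply: contra ba => bz; rewrite -(one _ _ bz az).
    have := active_lt az _ nb; rewrite inE /= => /(_ bf).
    by rewrite -!ht_pt.
  move: zx zy xy => [p /sub -> <-] [q /sub -> <-]; by rewrite eqxx.
apply/dimension_gt0P; exists (exponent a), (exponent b); split; try exact: active_subdivision.
by apply: contra ab => /eqP/exponent_inj->.
Qed.

Lemma tropical_locusP w : tropical_locus nu f w <->
  dir_span exponent (active_terms f w) != 0%VS.
Proof.
split=> [[a [b [af bf ab abmin]]]|/dir_span_neq0[a [b [az bz ab]]]].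
  have aD : a \in D by move/fsubsetP: fD; apply.
  have bD : b \in D by move/fsubsetP: fD; apply.
  have az : [` aD]%fset \in active_terms f w.
    by apply/active_termsP; split=> // c cf; rewrite /ht /= addrC [leRHS]addrC; case: (abmin c cf).
  have bz : [` bD]%fset \in active_terms f w.
    by apply/active_termsP; split=> // c cf; rewrite /ht /= addrC [leRHS]addrC; case: (abmin c cf).
  apply/negP => /dir_span_eq0P /(_ _ _ az bz) e; move: ab.
  by have /= -> := congr1 val e; rewrite eqxx.
have [af amin] := active_termsP _ _ az; have [bf bmin] := active_termsP _ _ bz.
exists (val a), (val b); split=> //.
move=> c cf; rewrite ![nu _ + _]addrC; split; [exact: amin|exact: bmin].
Qed.

End Cells.

(** * Directions and dimensions of polyhedra *)

Section Directions.
Variables (R : realType) (n : nat).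
Implicit Types (A B : set 'rV[R]_n) (x y v d : 'rV[R]_n) (U : {vspace 'rV[R]_n}).

Let dotl d (x : 'rV[R]_n) : R^o := dot d x.

Lemma dotl_is_linear d : linear (dotl d).
Proof. by move=> c x y; rewrite /dotl dotDr dotZr. Qed.

HB.instance Definition _ d :=
  GRing.isLinear.Build R 'rV[R]_n R^o _ (dotl d) (dotl_is_linear d).

Lemma orthogonal_lin_span A d : (forall x, A x -> dot d x = 0) -> orthogonal_to d (lin_span A).
Proof.
move=> dA u uA; have [_ /(_ (lker (linfun (dotl d))))] := lin_spanP A.
have sub x : A x -> x \in lker (linfun (dotl d)).
  by move=> /dA dx; rewrite memv_ker lfunE /= /dotl dx.
by move=> /(_ sub)/subvP/(_ u uA); rewrite memv_ker lfunE => /eqP.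
Qed.

Lemma orthogonal_full d : orthogonal_to d fullv -> d = 0.
Proof.
move=> od; apply: contrapT => /eqP d0.
have [|v [_ vd]] := @exists_orthogonal _ _ 0%VS d; first by rewrite memv0.
by move: vd; rewrite dotC od ?memvf// => /eqP; rewrite eq_sym oner_eq0.
Qed.

Lemma dim_full_rV : \dim (fullv : {vspace 'rV[R]_n}) = n.
Proof. by rewrite dimvf /dim /= mul1n. Qed.

Lemma full_dimensionP A : dimension A = n <->
  forall d, (forall x y, A x -> A y -> dot d (x - y) = 0) -> d = 0.
Proof.
split=> [An d dA|h].
  apply: orthogonal_full; suff <- : direction A = fullv.
    by apply: orthogonal_lin_span => _ [x Ax [y Ay <-]]; apply: dA.
  by apply/eqP; rewrite eqEdim subvf /= dim_full_rV -[X in (_ <= X)%N]/(dimension A) An.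
suff full : direction A = fullv by rewrite /dimension full dim_full_rV.
apply/eqP; rewrite eqEsubv subvf /=; apply/subvP => g _; apply: contrapT => /negP gA.
have [d [dA dg]] := exists_orthogonal gA.
have d0 : d = 0.
  apply: h => x y Ax Ay; apply: dA; apply: (lin_spanP (minkowski_diff A A)).1.
  by exists x => //; exists y.
by move: dg; rewrite d0 dot0l => /eqP; rewrite eq_sym oner_eq0.
Qed.

Lemma segment_in_component A x y :
  (forall s, 0 <= s -> s <= 1 -> A (x + s *: (y - x))) -> connected_component A x y.
Proof.
move=> seg; pose g (s : R) := x + s *: (y - x).
have gc : continuous g.
  move=> s; apply: cvgD; first exact: cvg_cst.
  by apply: cvgZr_tmp; exact: cvg_id.
have gI : connected (g @` `[0, 1]).
  apply: connected_continuous_connected; first exact: segment_connected.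
  exact: continuous_subspaceT.
apply: (connected_component_max (B := g @` `[0, 1])) => //.
- by exists 0; [rewrite /= in_itv /= lexx ler01|rewrite /g scale0r addr0].
- by move=> _ [s /= + <-]; rewrite in_itv /= => /andP[s0 s1]; apply: seg.
- by exists 1; [rewrite /= in_itv /= lexx ler01|rewrite /g scale1r addrC subrK].
Qed.

End Directions.

(** * Stable intersections of tropical hypersurfaces *)

Section Stable.
Variables (R : realType) (K : fieldType) (nu : K -> R) (n : nat) (I : finType).
Variables (f : I -> laurent K n) (Sigma : I -> weighted_complex R n).
Variable D : {fset 'rV[int]_n}.
Hypothesis fD : forall i, (finsupp (f i) `<=` D)%fset.
Hypothesis Sigma_f : forall i, is_hypersurface_of nu (f i) (Sigma i).
Implicit Types (x y z v w : 'rV[R]_n) (i j : I) (s t : seq I) (F : I -> {set D}).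

Local Notation ex := (@exponent R n D).
Local Notation A := (fun i => support_terms D (f i)).
Local Notation h := (fun i => @coef_val R K nu n D (f i)).
Local Notation active_at i x := (active ex (A i) (h i) x).
Local Notation local x := (local_span ex A h x).
Local Notation stable s i0 := (foldl (@stable_intersection R n) (Sigma i0) [seq Sigma i | i <- s]).

Definition cell_of i (B : {set D}) : set 'rV[R]_n := [set x | B \subset active_at i x].

Lemma cellsP i B : cells (Sigma i) B <->
  exists2 z, B = cell_of i (active_at i z) & dir_span ex (active_at i z) != 0%VS.
Proof.
have [_ -> _] := Sigma_f i; split=> [[Q [[z _ <-]] ]|[z -> d0]].
  rewrite (subdivision_dimension _ (@fD i)) => d0 <-.
  by exists z => //; exact: dual_cell_subdivision.
exists (subdivision_cell nu (f i) z); last exact: dual_cell_subdivision.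
by split; [exists z|rewrite (subdivision_dimension _ (@fD i))].
Qed.

Lemma complex_supportP i x : complex_support (Sigma i) x <-> local x i != 0%VS.
Proof. have [-> _ _] := Sigma_f i; exact: tropical_locusP. Qed.

(** By each transversality condition in the iterated stable intersection, a
    normal of the new cell does not lie in the span of normals of the cells
    intersected so far. *)
Lemma stable_cells_independent i0 s C : uniq (i0 :: s) -> cells (stable s i0) C ->
  exists e : I -> 'rV[R]_n, [/\ forall i, i \in i0 :: s -> e i \in global_span ex A i,
    forall i x y, i \in i0 :: s -> C x -> C y -> dot (e i) (x - y) = 0 &
    deficiency_le 0 0%VS (fun i => <[e i]>%VS) [set j in i0 :: s]%SET].
Proof.
have normal i B : cells (Sigma i) B -> exists u, [/\ u \in global_span ex A i, u != 0 &
    forall x y, B x -> B y -> dot u (x - y) = 0].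
  move=> /cellsP[z -> /dir_span_neq0[a [b [az bz ab]]]]; exists (ex a - ex b); split.
  - by apply: mem_dir_span; apply: (fintype.subsetP (active_sub _ _ _ _)); [exact: az|exact: bz].
  - by rewrite subr_eq0; apply: contra ab => /eqP/exponent_inj->.
  move=> x y zx zy; rewrite dotC.
  have := @orthogonal_common_active R n _ ex (A i) (h i) y x; apply.
  by apply: mem_dir_span; rewrite inE !(fintype.subsetP zx, fintype.subsetP zy).
elim/last_ind: s C => [|s i IH] C.
  move=> _ /normal[u [uG u0 uB]]; exists (fun=> u); split.
  - by move=> i; rewrite inE => /eqP->.
  - by move=> i x y _; apply: uB.
  have -> : [set j in [:: i0]]%SET = (i0 |: finset.set0)%SET by apply/setP => j; rewrite !inE orbF.
  apply: (@deficiency_leU1 _ _ _ _ _ _ _ u) => //; first by rewrite inE.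
    by rewrite join_span0 memv0.
  by move=> M; rewrite finset.subset0 => /eqP->; rewrite cards0 join_span0.
rewrite -rcons_cons rcons_uniq => /andP[iS us].
rewrite map_rcons foldl_rcons => -[B [E [/(IH _ us)[e [eG eB he]] /normal[u [uG u0 uE]] _ dBE [_ [l CE]]]]].
have CBE x : C x -> B x /\ E x by rewrite CE => -[[]].
pose e' j := if j == i then u else e j.
have e'i : e' i = u by rewrite /e' eqxx.
have e's j : j \in i0 :: s -> e' j = e j.
  by move=> js; rewrite /e' ifN //; apply: contraNneq iS => <-.
have e'P (P : I -> 'rV[R]_n -> Prop) : P i u -> (forall j, j \in i0 :: s -> P j (e j)) ->
    forall j, j \in rcons (i0 :: s) i -> P j (e' j).
  move=> Pi Ps j; rewrite mem_rcons inE => /orP[/eqP->|js]; first by rewrite e'i.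
  by rewrite e's//; apply: Ps.
exists e'; split.
- exact: (e'P (fun j v => v \in global_span ex A j)).
- move=> j x y js /CBE[Bx Ex] /CBE[By Ey].
  apply: (e'P (fun j v => dot v (x - y) = 0)) js; first exact: uE.
  by move=> k ks; exact: (eB k x y ks Bx By).
have -> : [set j in rcons (i0 :: s) i]%SET = (i |: [set j in i0 :: s])%SET.
  by apply/setP => j; rewrite finset.in_set mem_rcons in_cons finset.in_setU1 finset.in_set.
apply: (@deficiency_leU1 _ _ _ _ _ _ _ u); first by rewrite inE.
- by rewrite e'i.
- apply: contra u0 => uS; apply/eqP; have /full_dimensionP := dBE; apply.
  move=> _ _ [b1 Bb1 [c1 Ec1 <-]] [b2 Bb2 [c2 Ec2 <-]].
  rewrite opprD addrACA dotDr (uE c1 c2)// addr0 dotC.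
  suff : orthogonal_to (b1 - b2) (join_span 0 (fun j => <[e' j]>%VS) [set j in i0 :: s]%SET).
    by apply.
  apply: orthogonal_add; first by move=> x; rewrite memv0 => /eqP->; rewrite dot0r.
  apply: orthogonal_sum => j; rewrite inE => js; apply: orthogonal_line.
  by rewrite e's// dotC eB.
by apply: deficiency_leV he => j; rewrite inE => js; rewrite e's.
Qed.

Lemma active_move_along (J : {set I}) x v :
  (forall j, j \in J -> orthogonal_to v (local x j)) ->
  exists2 e, 0 < e & forall j, j \in J -> active_at j x \subset active_at j (x + e *: v).
Proof.
move=> ov; have [y [[e e0 ->] vy _]] := perturb ex A h x v.
exists e => // j jJ; apply: fintype.subset_trans (vy j).
apply/fintype.subsetP => a aa; apply/activeP; split=> // c ca.
by rewrite /term_value !add0r (orthogonal_dir_spanE (ov j jJ) aa ca).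
Qed.

Definition region F s : set 'rV[R]_n := [set x | forall j, j \in s -> F j \subset active_at j x].

(** The region of a flag contains a neighbourhood of one of its points in the
    orthogonal complement of the span of the faces, and so does the cell that
    comes next; as the spans are independent, these complements span the whole
    space. *)
Lemma flag_stable_cell F i0 s : flag ex A h F (rev (i0 :: s)) ->
  cells (stable s i0) (region F (i0 :: s)).
Proof.
have regionE t x : region F t x <-> region F (rev t) x.
  by split=> tx j; have := tx j; rewrite mem_rev.
elim/last_ind: s => [|s i IH].
  rewrite /rev /= => -[_ [z zE] d0 _ _]; apply/cellsP; exists z; last by rewrite -zE.
  apply/seteqP; split=> x; first by move=> /(_ i0); rewrite inE eqxx -zE; apply.
  by move=> zx j; rewrite inE => /eqP->; rewrite zE.
rewrite -rcons_cons rev_rcons => -[fs [z zE] d0 dis [y0 y0F y0E]].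
rewrite map_rcons foldl_rcons.
have [y yF ye] : exists2 y, region F (i0 :: s) y &
    (\sum_(j in [set j in rev (i0 :: s)]%SET) local y j <=
     \sum_(j in [set j in rev (i0 :: s)]%SET) dir_span ex (F j))%VS.
  move: fs; have : rev (i0 :: s) != [::] by rewrite -size_eq0 size_rev.
  case E : (rev (i0 :: s)) => [//|k t] _ [_ _ _ _ [y yF ye]].
  by exists y => //; apply/regionE; rewrite E.
have regionU : region F (rcons (i0 :: s) i) = region F (i0 :: s) `&` cell_of i (F i).
  apply/seteqP; split=> x.
    by move=> sx; split=> [j js|]; apply: sx; rewrite mem_rcons inE ?js ?orbT ?eqxx.
  by move=> [sx ix] j; rewrite mem_rcons inE => /orP[/eqP->//|]; apply: sx.
have nonempty : region F (i0 :: s) `&` cell_of i (F i) !=set0.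
  exists y0; rewrite -regionU; apply/regionE; rewrite rev_rcons => j; exact: y0F.
exists (region F (i0 :: s)), (cell_of i (F i)); split=> //.
- exact: IH.
- by apply/cellsP; exists z; rewrite -zE.
- apply/full_dimensionP => d dP.
  have d_local (B1 B2 : set 'rV[R]_n) U x b : (forall a1 a2 b, B1 a1 -> B1 a2 -> B2 b -> dot d (a1 - a2) = 0) ->
      B1 x -> B2 b -> (forall v, orthogonal_to v U -> exists2 e, 0 < e & B1 (x + e *: v)) -> d \in U.
    move=> dB Bx Bb mv; apply: contrapT => /negP dU.
    have [v [vU vd]] := exists_orthogonal dU.
    have [e e0 Be] := mv v vU; have := dB _ _ _ Be Bx Bb.
    rewrite addrC addKr dotZr dotC vd mulr1 => e00; by rewrite e00 ltxx in e0.
  have zz : cell_of i (F i) z by rewrite /cell_of /= zE; exact: fintype.subxx.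
  have : d \in (\sum_(j in [set j in rev (i0 :: s)]%SET) dir_span ex (F j) :&: dir_span ex (F i))%VS.
    rewrite memv_cap; apply/andP; split.
      apply: (d_local (region F (i0 :: s)) (cell_of i (F i)) _ y z) => //.
        move=> a1 a2 b a1P a2P bP.
        have -> : a1 - a2 = (a1 + b) - (a2 + b) by rewrite opprD addrACA subrr addr0.
        by apply: dP; [exists a1 => //; exists b|exists a2 => //; exists b].
      move=> v ov; have [|e e0 sub] := @active_move_along [set j in rev (i0 :: s)]%SET y v.
        by move=> j jS; apply: orthogonalS ov; apply: subv_trans ye; apply: (sumv_sup _ jS).
      exists e => // j js; apply: fintype.subset_trans (yF j js) (sub j _).
      by rewrite inE mem_rev.
    apply: (d_local (cell_of i (F i)) (region F (i0 :: s)) _ z y) => //.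
      move=> a1 a2 b a1P a2P bP.
      have -> : a1 - a2 = (b + a1) - (b + a2) by rewrite opprD addrACA subrr add0r.
      by apply: dP; exists b => //; [exists a1|exists a2].
    move=> v ov; have [|e e0 sub] := @active_move_along [set i]%SET z v.
      by move=> j; rewrite inE => /eqP->; move: ov; rewrite zE.
    exists e => //; rewrite /cell_of /= {1}zE; apply: sub; by rewrite inE.
  by rewrite dis memv0 => /eqP.
split; first by rewrite regionU.
exists 0; rewrite regionU; apply/seteqP; split=> x; last by case.
by move=> xP; split=> // y' _; rewrite !dot0l.
Qed.

Lemma monotone_reach_component w z : let X := \bigcap_(i in [set: I]) complex_support (Sigma i) in
  X w -> reach (monotone_step ex A h 0%VS finset.setT w) w z -> connected_component X w z.
Proof.
move=> X Xw; elim=> [|x y _ IH [_ mono]]; first exact: connected_component_refl.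
apply: connected_component_trans IH _; apply: segment_in_component => s s0 s1 i _.
apply/complex_supportP.
have hi : deficiency_le 0 0%VS (local w) [set i]%SET.
  by apply/deficiency_le_set1; rewrite subv0; apply/complex_supportP; exact: Xw.
have /deficiency_le_set1 := mono _ (finset.subsetT _) hi; rewrite subv0.
apply: contra => /eqP e0; rewrite -subv0 -e0; apply: dir_spanS.
exact: active_convex.
Qed.

End Stable.

(** * The components of the intersection *)

Theorem theorem3p3 (R : realType) (K : closedFieldType)
    (K_char0 : [pchar K] =i pred0)
    (nu : K -> R) (nu_valuation : is_valuation nu)
    (nu_nontrivial : nontrivial_valuation nu)
    (t : K) (t_neq0 : t != 0) (nu_t : nu t = 1)
    (n k : nat) (Sigma : 'I_k.+1 -> weighted_complex R n)
    (Sigma_hypersurface : forall i, is_tropical_hypersurface nu (Sigma i))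
    (stable_nonempty : cells (stable_intersections Sigma) !=set0) :
  let X : set 'rV[R]_n := \bigcap_(i in [set: 'I_k.+1]) complex_support (Sigma i) in
  forall C : set 'rV[R]_n, [set connected_component X x | x in X] C ->
    C `&` complex_support (stable_intersections Sigma) !=set0.
Proof.
move=> X _ [w Xw <-].
have /choice[f fS] i : exists f, is_hypersurface_of nu f (Sigma i).
  by have [f [_ ?]] := Sigma_hypersurface i; exists f.
pose D := (\bigcup_(i <- enum 'I_k.+1) finsupp (f i))%fset.
have fD i : (finsupp (f i) `<=` D)%fset.
  by apply: bigfcup_sup => //; rewrite mem_enum.
pose A i := support_terms D (f i).
pose h i := @coef_val R K nu n D (f i).
pose s := [seq lift ord0 i | i <- enum 'I_k].
have sE : ord0 :: s = enum 'I_k.+1 by rewrite enum_ordSl.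
have us : uniq (ord0 :: s) by rewrite sE enum_uniq.
have sT : [set j in ord0 :: s]%SET = finset.setT.
  by apply/setP => j; rewrite sE !inE mem_enum.
have stableE : stable_intersections Sigma =
    foldl (@stable_intersection R n) (Sigma ord0) [seq Sigma i | i <- s].
  by rewrite /stable_intersections /s -map_comp.
have gS : deficiency_le 0 0%VS (global_span (@exponent R n D) A) finset.setT.
  have [B BS] := stable_nonempty; rewrite stableE in BS.
  have [e [eG _ he]] := stable_cells_independent fD fS us BS.
  rewrite -sT; apply: deficiency_leV he => i; rewrite inE => /eG; by rewrite memvE.
have wX i : i \in finset.setT -> ~~ (local_span (@exponent R n D) A h w i <= 0)%VS.
  by move=> _; rewrite subv0; apply: (complex_supportP fD fS i w).1; exact: Xw.
have [z [wz hz]] := (joinable_all _ _ _).1 A h 0%VS finset.setT w erefl gS wX.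
have urs : uniq (rev (ord0 :: s)) by rewrite rev_uniq.
have [|F [flagF Fz _ _]] := @flag_exists R n _ _ (@exponent R n D) A h (rev (ord0 :: s)) 0%VS z urs.
  have -> // : [set j in rev (ord0 :: s)]%SET = finset.setT.
  by rewrite -sT; apply/setP => j; rewrite !inE mem_rev.
exists z; split; first exact: (monotone_reach_component fD fS Xw wz).
exists (region nu f F (ord0 :: s)).
  by rewrite stableE; apply: (flag_stable_cell fD fS).
by move=> j js; apply: Fz; rewrite mem_rev.
Qed.
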